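(* Let $\mathcal F,\mathcal H\in C^\infty(\mathfrak M_{0,-}^{\mathrm{reg}})^{\mathbb T^n}$, and let $f,h\in C^\infty(\mathfrak M_0^{\mathrm{reg}})^{\mathbb T^n}$ be any $\mathbb T^n$-invariant smooth functions whose restrictions to $\mathfrak M_{0,-}^{\mathrm{reg}}$ are $\mathcal F,\mathcal H$. For $i=1,2$ the value $\{\mathcal F,\mathcal H\}_{i,-}^{\mathrm{red}}(x):=\{f,h\}_i^{\mathrm{red}}(x)$ at $x\in\mathfrak M_{0,-}^{\mathrm{reg}}$ does not depend on the choice of extensions, this defines two compatible Poisson brackets on $C^\infty(\mathfrak M_{0,-}^{\mathrm{reg}})^{\mathbb T^n}$, and, with derivatives evaluated at $(e^q,J^-)$, $$\{\mathcal F,\mathcal H\}_{1,-}^{\mathrm{red}}(e^q,J^-)=\langle\nabla_1\mathcal F,d_2\mathcal H\rangle-\langle\nabla_1\mathcal H,d_2\mathcal F\rangle+\langle J^-,[R(q)d_2\mathcal F,d_2\mathcal H]+[d_2\mathcal F,R(q)d_2\mathcal H]\rangle,$$ $$\{\mathcal F,\mathcal H\}_{2,-}^{\mathrm{red}}(e^q,J^-)=\langle\nabla_1\mathcal F,\nabla_2\mathcal H\rangle-\langle\nabla_1\mathcal H,\nabla_2\mathcal F\rangle+2\langle\nabla_2\mathcal F,R(q)\nabla_2\mathcal H\rangle .$$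
   Context: $\mathcal G=\mathfrak{gl}(n,\mathbb C)$ (real Lie algebra) with $\langle X,Y\rangle=\Re\operatorname{tr}(XY)$. $\mathcal G^+=\mathfrak u(n)$ (anti-Hermitian), $\mathcal G^-=\mathrm i\,\mathfrak u(n)$ (Hermitian); $X=X^++X^-$ with $X^\pm=\frac12(X\mp X^* )$; $\mathcal G^\pm_0$ are the diagonal matrices in $\mathcal G^\pm$ and $X^-_0$ denotes the diagonal part of $X^-$. $\mathfrak M_0^{\mathrm{reg}}=\{(e^q,J): J\in\mathcal G,\ q=\mathrm{diag}(q_1,\dots,q_n),\ q_i\in\mathbb R,\ q_1>\dots>q_n\}$; the torus $\mathbb T^n$ of diagonal unitary matrices acts by $(e^q,J)\mapsto(e^q,\tau J\tau^{-1})$, and $C^\infty(\cdot)^{\mathbb T^n}$ denotes invariant smooth real functions. $\mathfrak M_{0,-}^{\mathrm{reg}}=\{(e^q,J)\in\mathfrak M_0^{\mathrm{reg}}:J^+=0\}$, with points written $(e^q,J^-)$. For $f\in C^\infty(\mathfrak M_0^{\mathrm{reg}})$: $\nabla_1f\in\mathcal G^-_0$ with $\langle\nabla_1f,X_0\rangle=\frac{d}{dt}|_0f(e^{q+tX_0},J)$ ($X_0\in\mathcal G_0^-$), $d_2f\in\mathcal G$ with $\langle d_2f,X\rangle=\frac{d}{dt}|_0f(e^q,J+tX)$, $\nabla_2f=J\,d_2f$, $\nabla_2'f=(d_2f)J$. For $\mathcal F\in C^\infty(\mathfrak M_{0,-}^{\mathrm{reg}})$: $\nabla_1\mathcal F\in\mathcal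 G_0^-$ defined likewise, $d_2\mathcal F\in\mathcal G^-$ with $\langle d_2\mathcal F,X\rangle=\frac{d}{dt}|_0\mathcal F(e^q,J^-+tX)$ for $X\in\mathcal G^-$, $\nabla_2\mathcal F=J^-d_2\mathcal F$. $R(q)\in\mathrm{End}(\mathcal G)$: $(R(q)X)_{ii}=0$, $(R(q)X)_{ij}=X_{ij}\coth(q_i-q_j)$ for $i\ne j$. The compatible Poisson brackets on $C^\infty(\mathfrak M_0^{\mathrm{reg}})^{\mathbb T^n}$ are $\{f,h\}_1^{\mathrm{red}}=\langle\nabla_1f,(d_2h)^-_0\rangle-\langle\nabla_1h,(d_2f)^-_0\rangle+\langle R(q)[d_2f,J]^+,(d_2h)^-\rangle-\langle R(q)[d_2h,J]^+,(d_2f)^-\rangle+\langle J^+,[(d_2f)^-,(d_2h)^-]-[(d_2f)^+,(d_2h)^+]\rangle$; $2\{f,h\}_2^{\mathrm{red}}=\langle\nabla_1f,(\nabla_2h+\nabla_2'h)^-_0\rangle-\langle\nabla_1h,(\nabla_2f+\nabla_2'f)^-_0\rangle+\langle R(q)[d_2f,J]^+,(\nabla_2h+\nabla_2'h)^-\rangle-\langle R(q)[d_2h,J]^+,(\nabla_2f+\nabla_2'f)^-\rangle+\langle(\nabla_2f)^-,(\nabla_2'h)^-\rangle+\langle(\nabla_2'f)^+,(\nabla_2h)^+\rangle-\langle(\nabla_2'f)^-,(\nabla_2h)^-\rangle-\langle(\nabla_2f)^+,(\nabla_2'h)^+\rangle$ (derivatives at $(e^q,J)$). *)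

(* Defs.v *)
From HB Require Import structures.
From mathcomp Require Import all_boot all_order all_algebra.
From mathcomp Require Import all_classical all_reals all_analysis.
From mathcomp.real_closed Require Import complex.
From Stdlib Require Import ClassicalEpsilon.
Import Order.TTheory GRing.Theory Num.Theory.
Import numFieldNormedType.Exports.
Local Open Scope ring_scope.

Set Implicit Arguments.
Unset Strict Implicit.
Unset Printing Implicit Defensive.

Section Defs.
Context {R : realType} {n : nat}.
Local Notation C := R[i].
Local Notation Mat := 'M[C]_n.     (* gl(n,C), viewed as a real Lie algebra *)
Local Notation Qs := 'rV[R]_n.     (* q = diag(q_1,...,q_n), stored as a row *)

Definition ip (X Y : Mat) : R := complex.Re (\tr (X *m Y)).
Definition adj (X : Mat) : Mat := (map_mx (fun z : C => Num.conj z) X)^T.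
Definition pplus (X : Mat) : Mat := 2^-1 *: (X - adj X).
Definition pminus (X : Mat) : Mat := 2^-1 *: (X + adj X).
Definition dpart (X : Mat) : Mat := \matrix_(i, j) if i == j then X i j else 0.
Definition comm (X Y : Mat) : Mat := X *m Y - Y *m X.
Definition coth (x : R) : R := (expR x + expR (- x)) / (expR x - expR (- x)).
Definition Rq (q : Qs) (X : Mat) : Mat :=
  \matrix_(i, j) if i == j then 0 else X i j * Complex (coth (q 0 i - q 0 j)) 0.

Definition is_herm (X : Mat) : Prop := adj X = X.
Definition is_diag_herm (X : Mat) : Prop := is_herm X /\ dpart X = X.

Definition Greg (q : Qs) : Prop := forall i j : 'I_n, (i < j)%N -> q 0 j < q 0 i.

(* functions of (e^q, J), parametrised by (q, J) *)
Definition MFun := Qs -> Mat -> R.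

Definition dirD (f : MFun) (q : Qs) (J : Mat) (x : Qs) (Y : Mat) : R :=
  derive1 (fun t : R => f (q + t *: x) (J + Complex t 0 *: Y)) 0.

Definition riesz (S : Mat -> Prop) (D : Mat -> R) : Mat :=
  epsilon (inhabits 0) (fun X => S X /\ forall Y, S Y -> ip X Y = D Y).

Definition diagvec (X0 : Mat) : Qs := \row_k complex.Re (X0 k k).

Definition nabla1 (f : MFun) q J : Mat :=
  riesz is_diag_herm (fun X0 => dirD f q J (diagvec X0) 0).
Definition d2 (f : MFun) q J : Mat := riesz (fun _ => True) (fun Y => dirD f q J 0 Y).
Definition nabla2 (f : MFun) q J : Mat := J *m d2 f q J.
Definition nabla2' (f : MFun) q J : Mat := d2 f q J *m J.
Definition d2m (F : MFun) q J : Mat := riesz is_herm (fun Y => dirD F q J 0 Y).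
Definition nabla2m (F : MFun) q J : Mat := J *m d2m F q J.

Definition br1 (f h : MFun) : MFun := fun q J =>
  let df := d2 f q J in let dh := d2 h q J in
  ip (nabla1 f q J) (dpart (pminus dh)) - ip (nabla1 h q J) (dpart (pminus df))
  + ip (Rq q (pplus (comm df J))) (pminus dh)
  - ip (Rq q (pplus (comm dh J))) (pminus df)
  + ip (pplus J) (comm (pminus df) (pminus dh) - comm (pplus df) (pplus dh)).

(* {f,h}_2^red  (the paper gives 2{f,h}_2^red) *)
Definition br2 (f h : MFun) : MFun := fun q J =>
  let df := d2 f q J in let dh := d2 h q J in
  let nf := nabla2 f q J in let nf' := nabla2' f q J in
  let nh := nabla2 h q J in let nh' := nabla2' h q J in
  2^-1 * (
    ip (nabla1 f q J) (dpart (pminus (nh + nh')))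
  - ip (nabla1 h q J) (dpart (pminus (nf + nf')))
  + ip (Rq q (pplus (comm df J))) (pminus (nh + nh'))
  - ip (Rq q (pplus (comm dh J))) (pminus (nf + nf'))
  + ip (pminus nf) (pminus nh') + ip (pplus nf') (pplus nh)
  - ip (pminus nf') (pminus nh) - ip (pplus nf) (pplus nh')).

Definition br1m (F H : MFun) : MFun := fun q J =>
  ip (nabla1 F q J) (d2m H q J) - ip (nabla1 H q J) (d2m F q J)
  + ip J (comm (Rq q (d2m F q J)) (d2m H q J) + comm (d2m F q J) (Rq q (d2m H q J))).
Definition br2m (F H : MFun) : MFun := fun q J =>
  ip (nabla1 F q J) (nabla2m H q J) - ip (nabla1 H q J) (nabla2m F q J)
  + 2 * ip (nabla2m F q J) (Rq q (nabla2m H q J)).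

Local Notation E := ('rV[R]_n * 'M[R]_n * 'M[R]_n)%type.
Definition cplx (A B : 'M[R]_n) : Mat := \matrix_(i, j) Complex (A i j) (B i j).
Definition lift (f : MFun) : E -> R := fun p => f p.1.1 (cplx p.1.2 p.2).
Definition Ereg : set E := [set p | Greg p.1.1].

Fixpoint iterD (vs : seq E) (g : E -> R) : E -> R :=
  match vs with
  | [::] => g
  | v :: vs' => fun x : E => 'D_v (iterD vs' g) x
  end.

Local Open Scope classical_set_scope.
Definition smooth_on (U : set E) (g : E -> R) : Prop :=
  forall (vs : seq E) (x : E), U x ->
    {for x, continuous (iterD vs g)} /\ forall v : E, derivable (iterD vs g) x v.

Local Open Scope ring_scope.

Definition conjt (t : 'I_n -> C) (J : Mat) : Mat := \matrix_(a, b) (t a * J a b * Num.conj (t b)).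
Definition unit_diag (t : 'I_n -> C) : Prop := forall k, t k * Num.conj (t k) = 1.

Definition SI0 (f : MFun) : Prop :=
  smooth_on Ereg (lift f) /\
  forall q J t, Greg q -> unit_diag t -> f q (conjt t J) = f q J.

(* C^oo(M_{0,-}^reg)^{T^n}: F only matters at Hermitian J; smoothness on the
   Hermitian slice is expressed by precomposing with the linear projection
   J |-> J^- onto G^- *)
Definition SIm (F : MFun) : Prop :=
  smooth_on Ereg (lift (fun q J => F q (pminus J))) /\
  forall q J t, Greg q -> is_herm J -> unit_diag t -> F q (conjt t J) = F q J.

Definition extends (f F : MFun) : Prop :=
  forall q J, Greg q -> is_herm J -> f q J = F q J.

Definition eqm (F G : MFun) : Prop :=
  forall q J, Greg q -> is_herm J -> F q J = G q J.

Definition fadd (F G : MFun) : MFun := fun q J => F q J + G q J.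
Definition fmul (F G : MFun) : MFun := fun q J => F q J * G q J.
Definition fscale (a : R) (F : MFun) : MFun := fun q J => a * F q J.

Definition poisson_m (b : MFun -> MFun -> MFun) : Prop :=
  (forall F H, SIm F -> SIm H -> SIm (b F H)) /\
  (forall F F' H, SIm F -> SIm F' -> SIm H -> eqm F F' -> eqm (b F H) (b F' H)) /\
  (forall a F G H, SIm F -> SIm G -> SIm H ->
      eqm (b (fadd (fscale a F) G) H) (fadd (fscale a (b F H)) (b G H))) /\
  (forall F H, SIm F -> SIm H -> eqm (b F H) (fscale (-1) (b H F))) /\
  (forall F G H, SIm F -> SIm G -> SIm H ->
      eqm (b F (fmul G H)) (fadd (fmul (b F G) H) (fmul G (b F H)))) /\
  (forall F G H, SIm F -> SIm G -> SIm H ->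
      eqm (fadd (fadd (b F (b G H)) (b G (b H F))) (b H (b F G))) (fun _ _ => 0)).

End Defs.

(* Main.v *)
Require Import Defs.
From mathcomp Require Import all_boot all_order all_algebra.
From mathcomp Require Import all_classical all_reals all_analysis.
From mathcomp.real_closed Require Import complex.
From mathcomp Require Import ring lra.
From Stdlib Require Import ClassicalEpsilon.
Import Order.TTheory GRing.Theory Num.Theory.
Import numFieldNormedType.Exports.
Local Open Scope ring_scope.

Set Implicit Arguments.
Unset Strict Implicit.
Unset Printing Implicit Defensive.

(** On the Hermitian slice [d_2 f] splits as [d_2 F] plus an anti-Hermitian part; the latter drops
    out of both brackets because [R(q)] is skew, [R(q) X^* = - (R(q) X)^*] and
    [<X^-, Y^-> - <X^+, Y^+> = <X, Y^*>].

    The pencil [{,}_2 + l {,}_1] is given by the formula of [{,}_2] with [J] replaced by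
    [M = J + l] wherever it multiplies a gradient, so the Jacobi identity of every member follows
    from a single computation and interpolation at [l = 0, 1, -1].  The Hamiltonian vector field of
    [F] is [q' = - (M d_2F)_0], [J' = A M + M A^*] with [A = nabla_1 F / 2 - R(q) (M d_2F)].
    Differentiating [{G, H}] along it, second derivatives cancel in the cyclic sum by Schwarz, and
    what remains is the modified classical Yang-Baxter equation for [R(q)], i.e.
    [coth x coth y + coth y coth z + coth z coth x = -1] for [x + y + z = 0], with the
    derivative of [R(q)] compensating for coinciding indices.  This last step needs the diagonal of
    [M d_2F] to be real, which is infinitesimal torus invariance. *)

(** Smoothness is given by iterated directional derivatives, so additivity of ['D_v g] in [v] and
    the symmetry of second derivatives are themselves derived from the mean value theorem. A slice
    function is pulled back along J -> J^- to an open set of a real normed space, where its full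
    gradient is automatically Hermitian. Hamiltonian directions can then be frozen at the point as
    constant vectors, to which Schwarz applies.

    The shift M = J + l works because R(q) takes Hermitian to anti-Hermitian matrices: the term 2
    l^2 <D, R(q) D'> vanishes, so the bracket is affine in l. The constant -1 in the coth identity
    leaves Re tr (L1 L2 L3 - L2 L1 L3) with Li = M Di; it is zero because taking adjoints reverses a
    word in Hermitian factors. Three values of l suffice because the Jacobi sum of a {,}_1 + b {,}_2
    is a quadratic form in (a, b). *)

(** * Directional derivatives: mean value theorem, additivity in the direction, Schwarz *)

Section DirectionalDerivatives.
Context {R : realType} {V : normedModType R}.
Implicit Types (g : V -> R) (p u v : V).
Local Open Scope classical_set_scope.

Lemma is_derive_line g p v (t0 d : R) :
  is_derive (p + t0 *: v) v g d <-> is_derive t0 1 (fun t : R => g (p + t *: v)) d.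
Proof.
have E : (fun h : R => h^-1 *: ((g \o shift (p + t0 *: v)) (h *: v) - g (p + t0 *: v)))
  = (fun h : R => h^-1 *: (((fun t : R => g (p + t *: v)) \o shift t0) (h *: (1 : R))
      - g (p + t0 *: v))).
  apply/funext => h /=; congr (_ *: (g _ - _)).
  by rewrite scalerDl addrCA /GRing.scale /= mulr1.
split=> -[H1 H2]; split.
- by move: H1; rewrite /derivable E.
- by move: H2; rewrite /derive E.
- by move: H1; rewrite /derivable E.
- by move: H2; rewrite /derive E.
Qed.

Lemma is_derive_line0 g p v (d : R) :
  is_derive p v g d <-> is_derive (0 : R) 1 (fun t : R => g (p + t *: v)) d.
Proof. by rewrite -[X in is_derive X]addr0 -(scale0r v); exact: is_derive_line. Qed.

Lemma derive1_line g p v : derivable g p v ->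
  derive1 (fun t : R => g (p + t *: v)) 0 = 'D_v g p.
Proof.
move=> H; rewrite derive1E.
have [|_ <-] := (is_derive_line g p v 0 ('D_v g p)).1; last by [].
by rewrite scale0r addr0; apply: DeriveDef.
Qed.

Lemma derive_scale g p v (c : R) : derivable g p v -> 'D_(c *: v) g p = c * 'D_v g p.
Proof.
move=> H.
have H0 : is_derive (c * 0 : R) 1 (fun t : R => g (p + t *: v)) ('D_v g p).
  by apply/is_derive_line; rewrite mulr0 scale0r addr0; apply: DeriveDef.
have Hc : is_derive (0 : R) 1 (fun t : R => c * t) c.
  by apply: is_derive_eq; rewrite /GRing.scale /= mulr1.
have := is_derive1_comp H0 Hc.
have -> : (fun t : R => g (p + t *: v)) \o (fun t : R => c * t)
   = (fun t : R => g (p + t *: (c *: v))).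
  by apply/funext => t /=; rewrite scalerA mulrC.
by move=> /is_derive_line; rewrite scale0r addr0 mulrC => -[].
Qed.

(** Both signs of [h] are covered and the intermediate point is bounded only by [|h|], so that
    difference quotients at 0 can be treated without case distinction. *)
Lemma MVT_line g p v (h : R) :
  (forall s : R, `|s| <= `|h| -> derivable g (p + s *: v) v) ->
  exists2 c : R, `|c| <= `|h| & g (p + h *: v) - g p = h * 'D_v g (p + c *: v).
Proof.
move=> H; set f := fun t : R => g (p + t *: v).
have df (s : R) : `|s| <= `|h| -> is_derive s 1 f ('D_v g (p + s *: v)).
  by move=> /H Hs; apply/is_derive_line; apply: DeriveDef.
have cf (a b : R) : (forall x : R, x \in `[a, b]%R -> `|x| <= `|h|) -> {within `[a, b], continuous f}.
  by move=> ab; apply: derivable_within_continuous => x xab; case: (df x (ab x xab)) => H1 _; exact: H1.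
have f0 : f 0 = g p by rewrite /f scale0r addr0.
suff [c ch E] : exists2 c : R, `|c| <= `|h| & f h - f 0 = h * 'D_v g (p + c *: v).
  by exists c => //; rewrite -f0.
case: (lerP 0 h) => h0.
  have ab (x : R) : x \in `[0, h]%R -> `|x| <= `|h|.
    by rewrite in_itv /= => /andP[x0 xh]; rewrite !ger0_norm.
  have D (x : R) : x \in `]0, h[%R -> is_derive x 1 f ('D_v g (p + x *: v)).
    by move=> xh; apply: df; apply: ab; apply: subset_itv_oo_cc.
  have [c ch ->] := MVT_segment h0 D (cf 0 h ab).
  by exists c; rewrite ?ab // subr0 mulrC.
have ab (x : R) : x \in `[h, 0]%R -> `|x| <= `|h|.
  by rewrite in_itv /= => /andP[x0 xh]; rewrite !ler0_norm ?lerN2 // ltW.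
have D (x : R) : x \in `]h, 0[%R -> is_derive x 1 f ('D_v g (p + x *: v)).
  by move=> xh; apply: df; apply: ab; apply: subset_itv_oo_cc.
have [c ch E] := MVT_segment (ltW h0) D (cf h 0 ab).
by exists c; rewrite ?ab // -[LHS]opprB E sub0r mulrN opprK mulrC.
Qed.

(** Keeps all mean value points that occur for steps of size [h] along [u] and [v] inside one
    neighbourhood of [p]. *)
Lemma near_square p u v (P : set V) : nbhs p P ->
  exists2 d : R, 0 < d & forall h : R, `|h| < d -> forall a b : R, `|a| <= `|h| -> `|b| <= `|h| ->
     P (p + a *: u + b *: v).
Proof.
move=> /nbhs_ballP[e /= e0 eP].
have M0 : 0 < `|u| + `|v| + 1 by rewrite ltr_wpDl ?addr_ge0.
exists (e / (`|u| + `|v| + 1)); first by rewrite divr_gt0.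
move=> h; rewrite ltr_pdivlMr // => hM a b ah bh.
apply: eP; rewrite -ball_normE /=.
rewrite -addrA opprD addrA subrr sub0r normrN.
apply: le_lt_trans hM; apply: (le_trans (ler_normD _ _)).
by rewrite !normrZ !mulrDr -[X in X <= _]addr0 !lerD ?mulr_ge0 //; exact: ler_wpM2r.
Qed.

(** Move along [u] first and then along [v]: the second leg is [h] times ['D_v g] at a mean value
    point tending to [p], where continuity of ['D_v g] gives the limit. *)
Lemma derive_add g p u v : derivable g p u ->
  (\forall y \near p, derivable g y v) -> {for p, continuous ('D_v g)} ->
  'D_(u + v) g p = 'D_u g p + 'D_v g p.
Proof.
move=> du dv cv; rewrite {1}/derive.
apply: cvg_lim => //.
have -> : (fun h : R => h^-1 *: ((g \o shift p) (h *: (u + v)) - g p)) =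
  (fun h : R => h^-1 *: ((g \o shift p) (h *: u) - g p)) \+
  (fun h : R => h^-1 *: (g (p + h *: u + h *: v) - g (p + h *: u))).
  apply/funext => h /=; rewrite -scalerDr; congr (_ *: _).
  by rewrite scalerDr ![_ + p]addrC addrA; ring.
apply: cvgD; first exact: du.
apply/cvgrPdist_lt => e e0.
have ce : \forall y \near p, `|'D_v g p - 'D_v g y| < e.
  by move/cvgrPdist_lt : cv; apply.
have [d d0 H] := @near_square p u v _ (filterI dv ce).
near=> h.
have hd : `|h| < d by near: h; exact: (@dnbhs0_lt R R^o).
have h0 : h != 0 by near: h; exact: nbhs_dnbhs_neq.
have [|c ch ->] := @MVT_line g (p + h *: u) v h.
  by move=> s sh; have [] := H h hd h s (lexx _) sh.
rewrite [_ *: _]mulKf //; exact: (H h hd h c (lexx _) ch).2.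
Unshelve. all: by end_near.
Qed.

(** The second difference of [g] over a small parallelogram is symmetric in [u] and [v]; divided by
    h^2, it approximates both mixed derivatives. *)
Lemma derive_swap g p u v :
  (\forall y \near p, derivable g y u) -> (\forall y \near p, derivable g y v) ->
  (\forall y \near p, derivable ('D_u g) y v) ->
  (\forall y \near p, derivable ('D_v g) y u) ->
  {for p, continuous ('D_v ('D_u g))} -> {for p, continuous ('D_u ('D_v g))} ->
  'D_v ('D_u g) p = 'D_u ('D_v g) p.
Proof.
move=> du dv duv dvu cvu cuv.
(* The mean value theorem is applied twice: to the increment [phi] along [w], then to ['D_w g] along
   [z]. *)
have key w z : (\forall y \near p, derivable g y w) ->
   (\forall y \near p, derivable ('D_w g) y z) ->
   {for p, continuous ('D_z ('D_w g))} -> forall e : R, 0 < e ->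
   exists2 d : R, 0 < d & forall h : R, `|h| < d -> h != 0 -> `|'D_z ('D_w g) p -
      (h * h)^-1 * (g (p + h *: w + h *: z) - g (p + h *: w) - (g (p + h *: z) - g p))| < e.
  move=> dw dwz c e e0.
  have ce : \forall y \near p, `|'D_z ('D_w g) p - 'D_z ('D_w g) y| < e.
    by move/cvgrPdist_lt : c; apply.
  have [d d0 H0] := @near_square p w z _ (filterI dw (filterI dwz ce)).
  exists d => // h hd h0; have {H0} H := H0 h hd.
  set phi := fun y : V => g (y + h *: z) - g y.
  have dphi s : `|s| <= `|h| -> is_derive (p + s *: w) w phi
      ('D_w g (p + s *: w + h *: z) - 'D_w g (p + s *: w)).
    move=> sh; have [D1 _] := H s h sh (lexx _).
    have n0 : `|0 : R| <= `|h| by rewrite normr0.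
    have [D2 _] := H s 0 sh n0; rewrite scale0r addr0 in D2.
    have I1 : is_derive (p + s *: w) w (fun y => g (y + h *: z))
        ('D_w g (p + s *: w + h *: z)).
      apply/is_derive_line.
      have -> : (fun t : R => g (p + t *: w + h *: z)) = (fun t => g ((p + h *: z) + t *: w)).
        by apply/funext => t; rewrite addrAC.
      by apply/is_derive_line; rewrite addrAC; exact: DeriveDef.
    exact: is_deriveB I1 (DeriveDef D2 erefl).
  have [|a ah E1] := @MVT_line phi p w h; first by move=> s /dphi [].
  have [|b bh E2] := @MVT_line ('D_w g) (p + a *: w) z h.
    by move=> s sh; have [_ []] := H a s ah sh.
  move: E1; have [_ ->] := dphi a ah; rewrite E2 /phi => ->.
  rewrite mulrA mulKf ?mulf_neq0 //; exact: (H a b ah bh).2.2.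
apply/eqP; rewrite -subr_eq0 -normr_le0; apply/ler_addgt0Pr => e e0; rewrite add0r.
have e20 : 0 < e / 2 by rewrite divr_gt0.
have [d1 d10 N1] := key u v du duv cvu (e / 2) e20.
have [d2 d20 N2] := key v u dv dvu cuv (e / 2) e20.
pose h := Num.min d1 d2 / 2; have m0 : 0 < Num.min d1 d2 by rewrite lt_min d10.
have h0 : h != 0 by rewrite mulf_neq0 ?gt_eqF.
have hm : `|h| < Num.min d1 d2.
  by rewrite gtr0_norm ?divr_gt0 // ltr_pdivrMr // ltr_pMr // ltr1n.
move: hm; rewrite lt_min => /andP[/N1 /(_ h0) H1 /N2 /(_ h0) H2].
rewrite [_ + h *: v + _]addrAC in H2.
move: H1 H2; set e1 := 'D_v _ p; set e2 := 'D_u _ p.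
have -> : g (p + h *: u + h *: v) - g (p + h *: v) - (g (p + h *: u) - g p)
   = g (p + h *: u + h *: v) - g (p + h *: u) - (g (p + h *: v) - g p) by ring.
set q := _^-1 * _ => H1 H2; apply: ltW.
rewrite (_ : e1 - e2 = (e1 - q) - (e2 - q)); last by ring.
apply: (le_lt_trans (ler_normB _ _)).
by rewrite [X in _ < X]splitr; exact: ltrD H1 H2.
Qed.

End DirectionalDerivatives.

(** * A class of expressions closed under differentiation *)

Section SmoothFunctions.
Context {R : realType} {n : nat}.
Local Notation E := ('rV[R]_n * 'M[R]_n * 'M[R]_n)%type.
Implicit Types (f g : E -> R) (p u v : E).
Local Open Scope classical_set_scope.

Lemma is_derive_linear (l : E -> R) p v :
  (forall u v, l (u + v) = l u + l v) -> (forall a v, l (a *: v) = a * l v) ->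
  is_derive p v l (l v).
Proof.
move=> lD lZ; apply: (is_derive_line0 _ _ _ _).2.
have -> : (fun t : R => l (p + t *: v)) = (fun t : R => l p + t * l v).
  by apply/funext => t; rewrite lD lZ.
by apply: is_derive_eq; rewrite scaler0 !add0r mul1r /GRing.scale /= mulr1.
Qed.

Lemma open_eq_derive (U : set E) f g p v : open U -> U p -> (forall x, U x -> f x = g x) ->
  derivable f p v -> derivable g p v /\ 'D_v g p = 'D_v f p.
Proof.
move=> Uo Up fg df.
have N : \forall x \near p, f x = g x.
  by apply: filterS (open_nbhs_nbhs (conj Uo Up)).
split; first exact: near_eq_derivable N df.
by apply/esym; exact: near_eq_derive N.
Qed.

(** Smoothness of a composite expression is read off from its shape, because this class is stable
    under ['D_v] up to equality on [U]. Nonvanishing and equality are demanded on [U] only: coth has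
    a pole where two q_i coincide, and gradient formulas hold at regular points. *)
Inductive sclos (U : set E) : (E -> R) -> Prop :=
| sclos_smooth g : smooth_on U g -> sclos U g
| sclos_cst c : sclos U (fun _ => c)
| sclos_lin l : continuous l -> (forall u v, l (u + v) = l u + l v) ->
    (forall a v, l (a *: v) = a * l v) -> sclos U l
| sclos_add f g : sclos U f -> sclos U g -> sclos U (fun x => f x + g x)
| sclos_mul f g : sclos U f -> sclos U g -> sclos U (fun x => f x * g x)
| sclos_inv f : sclos U f -> (forall x, U x -> f x != 0) -> sclos U (fun x => (f x)^-1)
| sclos_exp f : sclos U f -> sclos U (fun x => expR (f x))
| sclos_ext f g : sclos U f -> (forall x, U x -> f x = g x) -> sclos U g.

Lemma iterD_rcons (vs : seq E) v g : Defs.iterD vs ('D_v g) = Defs.iterD (rcons vs v) g.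
Proof. by elim: vs => //= w vs ->. Qed.

Lemma smooth_on_derive (U : set E) g v : smooth_on U g -> smooth_on U ('D_v g).
Proof. by move=> H vs x Ux; rewrite iterD_rcons; exact: H. Qed.

(** Regularity and stability go through one induction, since the product, inverse and exponential
    rules need derivability of the parts. In the case of [sclos_ext], openness turns equality on [U]
    into equality near each point. *)
Lemma sclos_derive (U : set E) g : open U -> sclos U g ->
  (forall x, U x -> {for x, continuous g} /\ forall v, derivable g x v) /\
  forall v, exists2 g', sclos U g' & forall x, U x -> 'D_v g x = g' x.
Proof.
move=> Uo; elim=> {g}.
- move=> g sg; split; first by move=> x Ux; exact: (sg [::] x Ux).
  by move=> v; exists ('D_v g) => //; apply: sclos_smooth; exact: smooth_on_derive.
- move=> c; split; first by move=> x Ux; split; [exact: cst_continuous|move=> v; exact: derivable_cst].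
  by move=> v; exists (fun=> 0); [exact: sclos_cst|move=> x _; rewrite derive_cst].
- move=> l lc lD lZ; split.
    by move=> x _; split=> [|v]; [exact: lc|case: (is_derive_linear x v lD lZ)].
  move=> v; exists (fun=> l v); first exact: sclos_cst.
  by move=> x _; have [_] := is_derive_linear x v lD lZ.
- move=> f g _ [f1 f2] _ [g1 g2] ; split.
    move=> x Ux; have [cf df] := f1 x Ux; have [cg dg] := g1 x Ux.
    by split=> [|v]; [exact: continuousD|exact: derivableD].
  move=> v; have [f' sf' Ef] := f2 v; have [g' sg' Eg] := g2 v.
  exists (fun x => f' x + g' x); first exact: sclos_add.
  move=> x Ux; have [cf df] := f1 x Ux; have [cg dg] := g1 x Ux.
  by rewrite -Ef // -Eg // -deriveD.
- move=> f g sf [f1 f2] sg [g1 g2]; split.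
    move=> x Ux; have [cf df] := f1 x Ux; have [cg dg] := g1 x Ux.
    by split=> [|v]; [exact: continuousM|exact: derivableM].
  move=> v; have [f' sf' Ef] := f2 v; have [g' sg' Eg] := g2 v.
  exists (fun x => f x * g' x + g x * f' x); first by apply: sclos_add; exact: sclos_mul.
  move=> x Ux; have [cf df] := f1 x Ux; have [cg dg] := g1 x Ux.
  by rewrite -Ef // -Eg //; rewrite -[RHS](deriveM (df v) (dg v)).
- move=> f sf [f1 f2] f0; split.
    move=> x Ux; have [cf df] := f1 x Ux; split=> [|v].
      by apply: continuousV => //; exact: f0.
    by apply: derivableV => //; exact: f0.
  move=> v; have [f' sf' Ef] := f2 v.
  exists (fun x => (-1) * ((f x)^-1 * (f x)^-1) * f' x).
    by do !apply: sclos_mul => //; [exact: sclos_cst|exact: sclos_inv|exact: sclos_inv].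
  move=> x Ux; have [cf df] := f1 x Ux.
  by rewrite [LHS](deriveV (f0 x Ux) (df v)) -Ef // /GRing.scale /= expr2 invfM mulN1r.
- move=> f sf [f1 f2]; have D x v : U x ->
      is_derive x v (fun x => expR (f x)) ('D_v f x * expR (f x)).
    move=> Ux; have [cf df] := f1 x Ux.
    apply: (is_derive_line0 _ _ _ _).2.
    have H1 : is_derive (0 : R) 1 (fun t : R => f (x + t *: v)) ('D_v f x).
      exact: (is_derive_line0 f x v _).1 (DeriveDef (df v) erefl).
    have Ex : f (x + 0 *: v) = f x by rewrite (scale0r v) (addr0 x).
    have := is_derive1_comp (is_derive_expR (f (x + 0 *: v))) H1.
    by rewrite Ex mulrC.
  split=> [x Ux|v].
    split=> [|v]; last by have [] := D x v Ux.
    have [cf df] := f1 x Ux.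
    by apply: continuous_comp => //; exact: continuous_expR.
  have [f' sf' Ef] := f2 v; exists (fun x => f' x * expR (f x)).
    by apply: sclos_mul => //; exact: sclos_exp.
  by move=> x Ux; have [_ ->] := D x v Ux; rewrite Ef.
- move=> f g sf [f1 f2] fg; split.
    move=> x Ux; have [cf df] := f1 x Ux; split=> [|v].
      have N : \forall y \near x, f y = g y.
        by apply: filterS (open_nbhs_nbhs (conj Uo Ux)) => y /fg.
      rewrite /prop_for /continuous_at -(fg x Ux).
      by apply: cvg_trans cf; exact: near_eq_cvg N.
    by have [] := open_eq_derive Uo Ux fg (df v).
  move=> v; have [f' sf' Ef] := f2 v; exists f' => // x Ux.
  have [cf df] := f1 x Ux.
  by rewrite -Ef //; have [] := open_eq_derive Uo Ux fg (df v).
Qed.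

Lemma sclos_smooth_on (U : set E) g : open U -> sclos U g -> smooth_on U g.
Proof.
move=> Uo sg vs.
have [g' sg' Eg] : exists2 g', sclos U g' & forall x, U x -> Defs.iterD vs g x = g' x.
  elim: vs => [|v vs [g' sg' Eg]] /=; first by exists g.
  have [h1 h2] := sclos_derive Uo sg'.
  have [g'' sg'' Eg''] := h2 v; exists g'' => // x Ux.
  rewrite -Eg'' //.
  by have [_] := open_eq_derive Uo Ux (fun y Uy => esym (Eg y Uy)) ((h1 x Ux).2 v).
have /(sclos_derive Uo)[H _] : sclos U (Defs.iterD vs g).
  by apply: sclos_ext sg' _ => x Ux; rewrite Eg.
by move=> x Ux; exact: H.
Qed.

End SmoothFunctions.

(** * Smooth functions in real coordinates, and the open set of regular points *)

Section Gradient.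
Context {R : realType} {n : nat}.
Local Notation E := ('rV[R]_n * 'M[R]_n * 'M[R]_n)%type.
Implicit Types (f g : E -> R) (p u v : E) (U : set E).
Local Open Scope classical_set_scope.

Lemma smooth_derivable U g p v : smooth_on U g -> U p -> derivable g p v.
Proof. by move=> H Up; have [_ /(_ v)] := H [::] p Up. Qed.

Lemma smooth_deriveD U g p u v : open U -> smooth_on U g -> U p ->
  'D_(u + v) g p = 'D_u g p + 'D_v g p.
Proof.
move=> Uo sg Up; apply: derive_add; first exact: smooth_derivable sg Up.
  apply: filterS (open_nbhs_nbhs (conj Uo Up)) => y Uy; exact: smooth_derivable sg Uy.
exact: (smooth_on_derive v sg [::] Up).1.
Qed.

Lemma smooth_deriveZ U g p (a : R) v : smooth_on U g -> U p ->
  'D_(a *: v) g p = a * 'D_v g p.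
Proof. by move=> sg Up; apply: derive_scale; exact: smooth_derivable sg Up. Qed.

Lemma smooth_schwarz U g p u v : open U -> smooth_on U g -> U p ->
  'D_v ('D_u g) p = 'D_u ('D_v g) p.
Proof.
move=> Uo sg Up; have N := open_nbhs_nbhs (conj Uo Up).
have su := smooth_on_derive u sg; have sv := smooth_on_derive v sg.
apply: derive_swap.
- by apply: filterS N => y Uy; exact: smooth_derivable sg Uy.
- by apply: filterS N => y Uy; exact: smooth_derivable sg Uy.
- by apply: filterS N => y Uy; exact: smooth_derivable su Uy.
- by apply: filterS N => y Uy; exact: smooth_derivable sv Uy.
- exact: (smooth_on_derive v su [::] Up).1.
- exact: (smooth_on_derive u sv [::] Up).1.
Qed.

Lemma linear_delta_sum m k (phi : 'M[R]_(m, k) -> R) :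
  (forall A B, phi (A + B) = phi A + phi B) -> (forall a A, phi (a *: A) = a * phi A) ->
  forall A, phi A = \sum_i \sum_j A i j * phi (delta_mx i j).
Proof.
move=> pD pZ A.
have p0 : phi 0 = 0 by rewrite -(scale0r 0) pZ mul0r.
rewrite {1}(matrix_sum_delta A) (big_morph phi pD p0); apply: eq_bigr => i _.
by rewrite (big_morph phi pD p0); apply: eq_bigr => j _; rewrite pZ.
Qed.

Definition eq_ (k : 'I_n) : E := (delta_mx 0 k, 0, 0).
Definition eA (i j : 'I_n) : E := (0, delta_mx i j, 0).
Definition eB (i j : 'I_n) : E := (0, 0, delta_mx i j).

Lemma pair3D (x x' : 'rV[R]_n) (A A' B B' : 'M[R]_n) :
  ((x, A, B) : E) + (x', A', B') = (x + x', A + A', B + B').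
Proof. by []. Qed.

Lemma pair3Z (a : R) (x : 'rV[R]_n) (A B : 'M[R]_n) :
  a *: ((x, A, B) : E) = (a *: x, a *: A, a *: B).
Proof. by []. Qed.

Lemma smooth_derive_sum U g p (x : 'rV[R]_n) (A B : 'M[R]_n) :
  open U -> smooth_on U g -> U p ->
  'D_(x, A, B) g p = \sum_k x 0 k * 'D_(eq_ k) g p +
   (\sum_i \sum_j A i j * 'D_(eA i j) g p + \sum_i \sum_j B i j * 'D_(eB i j) g p).
Proof.
move=> Uo sg Up.
have -> : ((x, A, B) : E) = (x, 0, 0) + ((0, A, 0) + (0, 0, B)).
  by rewrite !pair3D !addr0 !add0r.
rewrite !(smooth_deriveD _ _ Uo sg Up); congr (_ + (_ + _)).
- rewrite (@linear_delta_sum 1 n (fun x => 'D_((x, 0, 0) : E) g p)) ?big_ord1 //.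
  + move=> y z; rewrite -(smooth_deriveD _ _ Uo sg Up).
    by rewrite (pair3D y z) !addr0.
  + by move=> a y; rewrite -(smooth_deriveZ _ _ sg Up) (pair3Z a y) !scaler0.
- apply: (@linear_delta_sum n n (fun x => 'D_((0, x, 0) : E) g p)).
  + move=> y z; rewrite -(smooth_deriveD _ _ Uo sg Up).
    by rewrite (pair3D 0 0 y z) !addr0.
  + by move=> a y; rewrite -(smooth_deriveZ _ _ sg Up) (pair3Z a 0 y) !scaler0.
- apply: (@linear_delta_sum n n (fun x => 'D_((0, 0, x) : E) g p)).
  + move=> y z; rewrite -(smooth_deriveD _ _ Uo sg Up).
    by rewrite (pair3D 0 0 0 0 y z) !addr0.
  + by move=> a y; rewrite -(smooth_deriveZ _ _ sg Up) (pair3Z a 0 0 y) !scaler0.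
Qed.

Lemma continuous_q k : continuous (fun x : E => x.1.1 0 k).
Proof.
move=> p; apply: (@continuous_comp _ _ _ (fun x : E => x.1.1) (fun y : 'rV[R]_n => y 0 k)).
  by apply: (@continuous_comp _ _ _ (@fst ('rV[R]_n * 'M[R]_n)%type 'M[R]_n) fst); exact: cvg_fst.
exact: coord_continuous.
Qed.

Lemma continuous_A i j : continuous (fun x : E => x.1.2 i j).
Proof.
move=> p; apply: (@continuous_comp _ _ _ (fun x : E => x.1.2) (fun y : 'M[R]_n => y i j)).
  apply: (@continuous_comp _ _ _ (@fst ('rV[R]_n * 'M[R]_n)%type 'M[R]_n) snd); first exact: cvg_fst.
  exact: cvg_snd.
exact: coord_continuous.
Qed.

Lemma continuous_B i j : continuous (fun x : E => x.2 i j).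
Proof.
move=> p; apply: (@continuous_comp _ _ _ (fun x : E => x.2) (fun y : 'M[R]_n => y i j)).
  exact: cvg_snd.
exact: coord_continuous.
Qed.

Lemma open_Ereg : open (@Ereg R n).
Proof.
rewrite openE => p Up; rewrite /interior.
pose P (ij : 'I_n * 'I_n) : set E := [set x : E | (ij.1 < ij.2)%N -> x.1.1 0 ij.2 < x.1.1 0 ij.1].
suff H ij : nbhs (p : E) (P ij).
  by apply: filterS (filter_forall (nbhs_filter (p : E)) H) => x Hx i j; exact: (Hx (i, j)).
case: ij => i j; rewrite /P /=.
  have [ij|ij] := boolP (i < j)%N; last by apply: filterE.
  have c : {for p, continuous (fun x : E => x.1.1 0 i - x.1.1 0 j)}.
    by apply: continuousB; exact: continuous_q.
  have d0 : 0 < p.1.1 0 i - p.1.1 0 j by rewrite subr_gt0; exact: Up.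
  have := c; move/cvgrPdist_lt/(_ _ d0); apply: filterS => x /=.
  rewrite ltr_distlC => /andP[+ _] _; by rewrite subrr subr_gt0.
Qed.

Lemma sclos_q k : sclos (@Ereg R n) (fun x => x.1.1 0 k).
Proof.
by apply: (sclos_lin _ (@continuous_q k)) => [u v|a v]; rewrite mxE.
Qed.

Lemma sclos_A i j : sclos (@Ereg R n) (fun x => x.1.2 i j).
Proof.
by apply: (sclos_lin _ (@continuous_A i j)) => [u v|a v]; rewrite mxE.
Qed.

Lemma sclos_B i j : sclos (@Ereg R n) (fun x => x.2 i j).
Proof.
by apply: (sclos_lin _ (@continuous_B i j)) => [u v|a v]; rewrite mxE.
Qed.

Lemma expR_sub_neq0 (x : R) : x != 0 -> expR x - expR (- x) != 0.
Proof.
move=> x0; rewrite subr_eq0; apply/eqP => /expR_inj H.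
by move/eqP: x0; apply; lra.
Qed.

Lemma Greg_neq (q : 'rV[R]_n) i j : Greg q -> i != j -> q 0 i - q 0 j != 0.
Proof.
move=> H; rewrite neq_ltn subr_eq0 => /orP[] /H h; first by rewrite gt_eqF.
by rewrite lt_eqF.
Qed.

Lemma sclos_opp U f : sclos U f -> sclos U (fun x => - f x).
Proof.
move=> H; apply: (sclos_ext (sclos_mul (sclos_cst U (-1)) H)) => x _.
by rewrite mulN1r.
Qed.

Lemma sclos_sub U f g : sclos U f -> sclos U g -> sclos U (fun x => f x - g x).
Proof. by move=> Hf Hg; apply: sclos_add Hf (sclos_opp Hg). Qed.

Lemma sclos_coth i j : i != j -> sclos (@Ereg R n) (fun x => coth (x.1.1 0 i - x.1.1 0 j)).
Proof.
move=> ij; have Hd := sclos_sub (sclos_q i) (sclos_q j).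
have H1 := sclos_exp Hd; have H2 := sclos_exp (sclos_opp Hd).
apply: (sclos_mul (sclos_add H1 H2)); apply: sclos_inv (sclos_sub H1 H2) _ => x Ux.
exact/expR_sub_neq0/Greg_neq.
Qed.

Lemma sclos_sum U I (r : seq I) (P : pred I) (F : I -> E -> R) :
  (forall i, sclos U (F i)) -> sclos U (fun x => \sum_(i <- r | P i) F i x).
Proof.
move=> H; elim: r => [|i r IH].
  by apply: (sclos_ext (sclos_cst U 0)) => x _; rewrite big_nil.
have [Pi|Pi] := boolP (P i).
  by apply: (sclos_ext (sclos_add (H i) IH)) => x _; rewrite big_cons Pi.
by apply: (sclos_ext IH) => x _; rewrite big_cons (negbTE Pi).
Qed.

End Gradient.

(** * Identities for an invariant form, an involution and a skew operator on an abstract ring *)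

Section TraceFormAlgebra.
Context {R : realType} {A : pzRingType} (tr : A -> A -> R) (st K : A -> A).
Context (trC : forall x y, tr x y = tr y x)
  (trM : forall x y z, tr (x * y) z = tr x (y * z))
  (trD : forall x y z, tr (x + y) z = tr x z + tr y z)
  (trN : forall x z, tr (- x) z = - tr x z)
  (tr_st : forall x y, tr (st x) (st y) = tr x y)
  (stK : forall x, st (st x) = x)
  (stM : forall x y, st (x * y) = st y * st x)
  (KD : forall x y, K (x + y) = K x + K y)
  (KN : forall x, K (- x) = - K x)
  (trK : forall x y, tr (K x) y = - tr x (K y))
  (Kst : forall x, K (st x) = - st (K x)).

Let trDr x y z : tr z (x + y) = tr z x + tr z y.
Proof. by rewrite trC trD !(trC z). Qed.

Let trNr x z : tr z (- x) = - tr z x.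
Proof. by rewrite trC trN (trC z). Qed.

Let trcyc x y z : tr x (y * z) = tr y (z * x).
Proof. by rewrite trC trM. Qed.

(** Skewness moves [K] off the commutators and cyclicity matches the terms; this yields the Lie
    bracket form of the first reduced bracket. *)
Lemma tr_bracket1 (J a b : A) :
  tr (K (a * J - J * a)) b - tr (K (b * J - J * b)) a =
  tr J (K a * b - b * K a + (a * K b - K b * a)).
Proof.
rewrite !trK !(trD, trN, trM, trDr, trNr).
by rewrite (trcyc a J) (trcyc b J); ring.
Qed.

Lemma tr_K_st_st x y : tr (K (st x)) (st y) = - tr (K x) y.
Proof. by rewrite Kst trN tr_st. Qed.

(** Meant for x = J a, y = J b with Hermitian J, a, b, when [st x - x] is [a, J] and [y + st y] is
    an anticommutator. Terms with exactly one star cancel; each of the two pairings contributes 2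
    <x, K y>. *)
Lemma tr_bracket2 (x y : A) :
  tr (K (st x - x)) (y + st y) - tr (K (st y - y)) (x + st x) = 4 * tr x (K y).
Proof.
rewrite !(KD, KN) !(trD, trN, trDr, trNr) !tr_K_st_st.
rewrite (trK (st x) y) (trC (st x) (K y)) (trK (st y) x) (trC (st y) (K x)).
by rewrite (trK y x) (trC y (K x)) (trK x y); ring.
Qed.

(** [K y] is anti-self-adjoint, hence orthogonal to [x]. This removes the l^2 term under J -> J +
    l. *)
Lemma tr_K_herm x y : st x = x -> st y = y -> tr x (K y) = 0.
Proof.
move=> Hx Hy; have E : tr (K y) x = - tr (K y) x by rewrite -{1}Hx -{1}Hy tr_K_st_st.
rewrite trC; lra.
Qed.

(** The right side is the coefficient of l in 2 <(J + l) a, K ((J + l) b)>: the cubic part of the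
    first bracket is the derivative of that of the second along the shift. *)
Lemma tr_pencil (J a b : A) : st J = J -> st a = a -> st b = b ->
  tr J (K a * b - b * K a + (a * K b - K b * a)) =
  2 * (tr a (K (J * b)) + tr (J * a) (K b)).
Proof.
move=> HJ Ha Hb; rewrite !(trDr, trNr).
have key x y : st x = x -> st y = y -> tr (K x) (y * J) = tr x (K (J * y)).
  move=> Hx Hy; have -> : y * J = st (J * y) by rewrite stM HJ Hy.
  by rewrite -{1}Hx tr_K_st_st trK opprK.
rewrite (trcyc J (K a)) (key a b Ha Hb) (trcyc J (K b)) (key b a Hb Ha).
have -> : tr J (b * K a) = - tr a (K (J * b)) by rewrite -trM trC trK.
by rewrite -trM (trC b (K (J * a))) trK; ring.
Qed.

(** The two summands on the right pair equally with a self-adjoint [b], which is why [p] is half of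
    the q-gradient. Collecting what multiplies [b] exhibits J' of the Hamiltonian vector field. *)
Lemma tr_hamiltonian (M p l b : A) : st M = M -> st b = b ->
  tr (p + p) (M * b) + 2 * tr l (K (M * b)) =
  tr b ((p - K l) * M + M * st (p - K l)).
Proof.
move=> HM Hb; rewrite trDr; set a := p - K l.
have -> : tr b (M * st a) = tr b (a * M).
  by rewrite -[RHS]tr_st Hb stM HM.
have -> : tr b (a * M) = tr a (M * b) by rewrite trcyc.
by rewrite /a !(trD, trN) trK; ring.
Qed.

(* [l = M a], [A = p - K l]; the terms in [A l A^*] drop out of the cyclic sum because
   [Re tr (A M B^* d)] is symmetric in [A] and [B] for Hermitian [M], [d]. *)
Lemma tr_jacobi (M : A) (p1 p2 p3 d1 d2 d3 : A) (S1 S2 S3 : A -> A) :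
  st M = M -> st d1 = d1 -> st d2 = d2 -> st d3 = d3 ->
  let a1 := p1 - K (M * d1) in let a2 := p2 - K (M * d2) in let a3 := p3 - K (M * d3) in
  let Y1 := a1 * M + M * st a1 in let Y2 := a2 * M + M * st a2 in
  let Y3 := a3 * M + M * st a3 in
  let expl p2 p3 d2 d3 Y1 S1 := tr (p2 + p2) (Y1 * d3) - tr (p3 + p3) (Y1 * d2) +
    2 * (tr (Y1 * d2) (K (M * d3)) + tr (M * d2) (S1 (M * d3)) + tr (M * d2) (K (Y1 * d3))) in
  tr (a2 * a1 - a1 * a2) (M * d3) + tr (a3 * a2 - a2 * a3) (M * d1)
   + tr (a1 * a3 - a3 * a1) (M * d2)
   + tr (M * d2) (S1 (M * d3)) + tr (M * d3) (S2 (M * d1)) + tr (M * d1) (S3 (M * d2)) = 0 ->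
  expl p2 p3 d2 d3 Y1 S1 + expl p3 p1 d3 d1 Y2 S2 + expl p1 p2 d1 d2 Y3 S3 = 0.
Proof.
move=> HM H1 H2 H3 a1 a2 a3 Y1 Y2 Y3 expl.
have E q2 q3 e2 e3 b1 S : let Y := b1 * M + M * st b1 in
    expl q2 q3 e2 e3 Y S = 2 * (tr (q2 - K (M * e2)) (Y * e3)
      - tr (q3 - K (M * e3)) (Y * e2) + tr (M * e2) (S (M * e3))).
  move=> Y; rewrite /expl !trD !trN !trK (trC (Y * e2) (K (M * e3))) trK.
  by ring.
have F b c e : tr b ((c * M + M * st c) * e) = tr (b * c) (M * e) + tr b (M * st c * e).
  by rewrite mulrDl trDr -mulrA trM.
have Sy b c e : st e = e -> tr b (M * st c * e) = tr c (M * st b * e).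
  by move=> He; rewrite trC -[LHS]tr_st !stM stK He HM trM trcyc trM mulrA.
rewrite /Y1 /Y2 /Y3 !E -/a1 -/a2 -/a3 !F.
rewrite (Sy a3 a1 d2 H2) (Sy a1 a2 d3 H3) (Sy a2 a3 d1 H1).
rewrite !(trD, trN) => H.
set t1 := tr (M * d2) (S1 _) in H *; set t2 := tr _ (S2 _) in H *; set t3 := tr _ (S3 _) in H *.
by lra.
Qed.

(** On expanding [a_i = p_i - k_i], terms with two factors [p] vanish by commutation, and those
    linear in one [p_i] assemble into the three vanishing pairings. The Yang-Baxter identity for
    K(l_i) thereby extends to the full matrices of the Hamiltonian flows. *)
Lemma tr_diagonal_shift (p1 p2 p3 k1 k2 k3 l1 l2 l3 : A) (s : R) :
  p2 * p1 = p1 * p2 -> p3 * p2 = p2 * p3 -> p1 * p3 = p3 * p1 ->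
  tr p1 (k2 * l3 - l3 * k2 + (l2 * k3 - k3 * l2)) = 0 ->
  tr p2 (k3 * l1 - l1 * k3 + (l3 * k1 - k1 * l3)) = 0 ->
  tr p3 (k1 * l2 - l2 * k1 + (l1 * k2 - k2 * l1)) = 0 ->
  let a1 := p1 - k1 in let a2 := p2 - k2 in let a3 := p3 - k3 in
  tr (k2 * k1 - k1 * k2) l3 + tr (k3 * k2 - k2 * k3) l1 + tr (k1 * k3 - k3 * k1) l2 + s = 0 ->
  tr (a2 * a1 - a1 * a2) l3 + tr (a3 * a2 - a2 * a3) l1 + tr (a1 * a3 - a3 * a1) l2 + s = 0.
Proof.
move=> c21 c32 c13 H1 H2 H3 a1 a2 a3.
have E p q k m l : p * q = q * p -> tr ((p - k) * (q - m) - (q - m) * (p - k)) l =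
    tr (k * m - m * k) l - tr p (m * l - l * m) + tr q (k * l - l * k).
  move=> pq; rewrite !(mulrDl, mulrDr, mulrN, mulNr, opprK, opprD) pq.
  have f1 x y : tr x (y * l) = tr (x * y) l by rewrite trM.
  have f2 x y : tr x (l * y) = tr (y * x) l by rewrite trcyc trC.
  by rewrite !(trD, trN, trDr, trNr) !f1 !f2; ring.
rewrite /a1 /a2 /a3 (E _ _ _ _ _ c21) (E _ _ _ _ _ c32) (E _ _ _ _ _ c13).
move: H1 H2 H3; rewrite !(trDr, trNr); lra.
Qed.

End TraceFormAlgebra.

(** * The modified Yang-Baxter identity for entrywise multiplication by coth *)

Section CothMatrices.
Context {C : comPzRingType} {n : nat} (k s : 'I_n -> 'I_n -> C).
Context (kC : forall i j, k j i = - k i j) (k0 : forall i, k i i = 0)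
  (sC : forall i j, s j i = s i j) (s0 : forall i, s i i = 0)
  (sk : forall i j, i != j -> s i j = 1 - k i j * k i j)
  (kkk : forall i j l, i != j -> j != l -> l != i ->
    k i j * k j l + k j l * k l i + k l i * k i j = -1).
Local Notation Mat := 'M[C]_n.
Implicit Types (X Y F G H P Q : Mat).

Definition hadamard X : Mat := \matrix_(i, j) (X i j * k i j).
(** With k = coth(q_i - q_j) and s = 1 - k^2 its derivative, this is the variation of R(q) X when q
    moves with velocity minus the diagonal of F. *)
Definition hadamard_dot F X : Mat := \matrix_(i, j) (X i j * (s i j * (F j j - F i i))).

Lemma mxtrace_mul2 X Y : \tr (X *m Y) = \sum_i \sum_j X i j * Y j i.
Proof. by apply: eq_bigr => i _; rewrite mxE. Qed.

Lemma mxtrace_mul3 X Y F :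
  \tr (X *m Y *m F) = \sum_i \sum_j \sum_l X i j * Y j l * F l i.
Proof.
rewrite mxtrace_mul2; apply: eq_bigr => i _; rewrite exchange_big /=.
by apply: eq_bigr => l _; rewrite mxE big_distrl.
Qed.

Lemma sum_delta (i : 'I_n) (f : 'I_n -> C) : \sum_j (i == j)%:R * f j = f i.
Proof.
rewrite (bigD1 i) //= eqxx mul1r big1 ?addr0 // => j /negbTE ji.
by rewrite eq_sym ji mul0r.
Qed.

(** For distinct indices the weight is -1. If exactly two coincide, a single product survives and
    equals -k^2 = s - 1; if all three coincide, it is 0 = -1 + 1. The right side collects these
    corrections to -1. *)
Lemma sum_coth_weight (Q : 'I_n -> 'I_n -> 'I_n -> C) :
  \sum_i \sum_j \sum_l (k i j * k j l + k j l * k l i + k l i * k i j) * Q i j l =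
  - (\sum_i \sum_j \sum_l Q i j l) + \sum_i \sum_j s i j * (Q i i j + Q i j j + Q i j i)
  + \sum_i Q i i i.
Proof.
have W i j l : k i j * k j l + k j l * k l i + k l i * k i j =
    -1 + ((i == j)%:R * s i l + (j == l)%:R * s i j + (i == l)%:R * s i j
     + (i == j)%:R * (i == l)%:R).
  have [<-|ij] := eqVneq i j; have [<-|il] := eqVneq i l.
  - by rewrite s0 k0 /= mulr1n; ring.
  - by rewrite s0 (sk il) k0 (kC i l) /= mulr0n mulr1n; ring.
  - by rewrite eq_sym (negbTE ij) (sk ij) k0 (kC i j) ?eqxx /= ?mulr0n ?mulr1n; ring.
  have [<-|jl] := eqVneq j l; first by rewrite (sk ij) k0 (kC i j) ?eqxx /= ?mulr0n ?mulr1n; ring.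
  have li : l != i by rewrite eq_sym.
  by rewrite (kkk ij jl li) /= mulr0n; ring.
have -> : \sum_i \sum_j s i j * (Q i i j + Q i j j + Q i j i) =
  \sum_i \sum_j \sum_l ((i == j)%:R * (s i l * Q i j l) + (j == l)%:R * (s i j * Q i j l)
   + (i == l)%:R * (s i j * Q i j l)).
  apply: eq_bigr => i _; rewrite [RHS]exchange_big /=.
  under [RHS]eq_bigr => l _ do rewrite !big_split /= sum_delta.
  rewrite !big_split /= [X in _ = _ + X + _]exchange_big [X in _ = _ + _ + X]exchange_big /=.
  under [X in _ = _ + X + _]eq_bigr => l _ do rewrite sum_delta.
  under [X in _ = _ + _ + X]eq_bigr => l _ do rewrite sum_delta.
  by rewrite -!big_split /=; apply: eq_bigr => j _; ring.
have -> : \sum_i Q i i i = \sum_i \sum_j \sum_l (i == j)%:R * ((i == l)%:R * Q i j l).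
  apply: eq_bigr => i _; rewrite exchange_big /=.
  under eq_bigr => l _ do rewrite sum_delta.
  by rewrite sum_delta.
rewrite -sumrN -!big_split; apply: eq_bigr => i _.
rewrite -sumrN -!big_split; apply: eq_bigr => j _.
rewrite -sumrN -!big_split; apply: eq_bigr => l _ /=.
by rewrite W; ring.
Qed.

(** The six products with two factors [hadamard], written as index sums, combine to the coth weight
    times [Q]. Its constant -1 produces the right side, and its corrections at coinciding indices
    cancel the [hadamard_dot] terms. *)
Lemma mxtrace_schouten F G H :
  \tr ((hadamard G *m hadamard F - hadamard F *m hadamard G) *m H) +
  \tr ((hadamard H *m hadamard G - hadamard G *m hadamard H) *m F) +
  \tr ((hadamard F *m hadamard H - hadamard H *m hadamard F) *m G) +
  \tr (G *m hadamard_dot F H) + \tr (H *m hadamard_dot G F) + \tr (F *m hadamard_dot H G) =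
  \tr (F *m G *m H) - \tr (G *m F *m H).
Proof.
rewrite !mulmxBl !raddfB /=.
have c1 X Y Z : \tr (X *m Y *m Z) = \tr (Y *m Z *m X) by rewrite -mulmxA mxtrace_mulC.
rewrite (c1 (hadamard H) (hadamard G)) (c1 (hadamard G) (hadamard H)) (c1 (hadamard H) F).
rewrite -(c1 G (hadamard F)) (c1 (hadamard H) (hadamard F)).
rewrite !mxtrace_mul3 !mxtrace_mul2.
pose Q i j l := G i j * F j l * H l i - F i j * G j l * H l i.
have := sum_coth_weight Q.
have -> : \sum_i Q i i i = 0 by apply: big1 => i _; rewrite /Q; ring.
have E : \sum_i \sum_j s i j * (Q i i j + Q i j j + Q i j i) =
   - (\sum_i \sum_j G i j * hadamard_dot F H j i + \sum_i \sum_j H i j * hadamard_dot G F j i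
     + \sum_i \sum_j F i j * hadamard_dot H G j i).
  (* By symmetry of [s], the combined summand is [v i j - v j i], whose double sum is zero. *)
  pose v i l := s i l * ((G i i - G l l) * F i l * H l i + H i i * G i l * F l i).
  apply/eqP; rewrite -addr_eq0 -!big_split /=; apply/eqP.
  transitivity (\sum_i \sum_j (v i j - v j i)).
    apply: eq_bigr => i _; rewrite -!big_split /=; apply: eq_bigr => j _.
    by rewrite /v /Q !mxE !(sC j i); ring.
  under eq_bigr => i _ do rewrite big_split /=.
  rewrite big_split /= [X in _ + X]exchange_big /= -big_split /= big1 // => i _.
  by rewrite -big_split /= big1 // => j _; rewrite subrr.
rewrite E addr0.
have -> : \sum_i \sum_j \sum_l Q i j l =
    \sum_i \sum_j \sum_l G i j * F j l * H l i - \sum_i \sum_j \sum_l F i j * G j l * H l i.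
  rewrite -sumrB; apply: eq_bigr => i _; rewrite -sumrB; apply: eq_bigr => j _.
  by rewrite -sumrB.
have -> : \sum_i \sum_j \sum_l
     (k i j * k j l + k j l * k l i + k l i * k i j) * Q i j l =
   \sum_i \sum_j \sum_l hadamard G i j * hadamard F j l * H l i
   + \sum_i \sum_j \sum_l G i j * hadamard F j l * hadamard H l i
   + \sum_i \sum_j \sum_l hadamard G i j * F j l * hadamard H l i
   - \sum_i \sum_j \sum_l hadamard F i j * hadamard G j l * H l i
   - \sum_i \sum_j \sum_l F i j * hadamard G j l * hadamard H l i
   - \sum_i \sum_j \sum_l hadamard F i j * G j l * hadamard H l i.
  rewrite -!sumrN -!big_split; apply: eq_bigr => i _.
  rewrite -!sumrN -!big_split; apply: eq_bigr => j _.
  rewrite -!sumrN -!big_split; apply: eq_bigr => l _ /=.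
  by rewrite /Q !mxE; ring.
move/eqP; rewrite -subr_eq0 => /eqP Hw.
apply/eqP; rewrite -subr_eq0 -[X in _ == X]Hw; apply/eqP; ring.
Qed.

(** Only diagonal entries of the second factor matter, and there the weights enter as
    [k i j + k j i], which is zero. *)
Lemma mxtrace_diag_hadamard P X Y : (forall i j, i != j -> P i j = 0) ->
  \tr (P *m (hadamard X *m Y - Y *m hadamard X + (X *m hadamard Y - hadamard Y *m X))) = 0.
Proof.
move=> HP; rewrite mxtrace_mul2 big1 // => i _.
rewrite (bigD1 i) //= big1 ?addr0 => [|j ji]; last by rewrite HP ?mul0r // eq_sym.
rewrite !mxE -!sumrB -big_split /= big1 ?mulr0 // => j _.
by rewrite !mxE (kC i j); ring.
Qed.

Lemma diag_mx_comm P Q : (forall i j, i != j -> P i j = 0) ->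
  (forall i j, i != j -> Q i j = 0) -> P *m Q = Q *m P.
Proof.
move=> HP HQ; apply/matrixP => i j; rewrite !mxE; apply: eq_bigr => l _.
have [->|il] := eqVneq i l; last by rewrite (HP _ _ il) (HQ _ _ il) !mul0r.
have [->|lj] := eqVneq l j; last by rewrite (HP _ _ lj) (HQ _ _ lj) !mulr0.
by rewrite mulrC.
Qed.

End CothMatrices.

(** * The real trace form, Hermitian splitting and R(q) on complex matrices *)

Section TraceForm.
Context {R : realType} {n : nat}.
Local Notation C := R[i].
Local Notation Mat := 'M[C]_n.
Local Notation Qs := 'rV[R]_n.
Implicit Types (q : Qs) (X Y Z J : Mat).
Local Notation Re := (@complex.Re R).
Local Notation Im := (@complex.Im R).

Lemma ReD (x y : C) : Re (x + y) = Re x + Re y. Proof. by case: x y => [? ?] []. Qed.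
Lemma ReN (x : C) : Re (- x) = - Re x. Proof. by case: x. Qed.
Lemma ReM (x y : C) : Re (x * y) = Re x * Re y - Im x * Im y.
Proof. by case: x y => [? ?] []. Qed.
Lemma ImM (x y : C) : Im (x * y) = Re x * Im y + Im x * Re y.
Proof. by case: x y => [? ?] []. Qed.
Lemma ImD (x y : C) : Im (x + y) = Im x + Im y. Proof. by case: x y => [? ?] []. Qed.
Lemma ImN (x : C) : Im (- x) = - Im x. Proof. by case: x. Qed.
Lemma Re_conj (x : C) : Re (Num.conj x) = Re x. Proof. by case: x. Qed.
Lemma Im_conj (x : C) : Im (Num.conj x) = - Im x. Proof. by case: x. Qed.
Lemma Re_sum I (r : seq I) (P : pred I) (F : I -> C) :
  Re (\sum_(i <- r | P i) F i) = \sum_(i <- r | P i) Re (F i).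
Proof. exact: (big_morph _ ReD). Qed.
Lemma Im_sum I (r : seq I) (P : pred I) (F : I -> C) :
  Im (\sum_(i <- r | P i) F i) = \sum_(i <- r | P i) Im (F i).
Proof. exact: (big_morph _ ImD). Qed.
Lemma complex_eqP (x y : C) : Re x = Re y -> Im x = Im y -> x = y.
Proof. by case: x y => [? ?] [? ?] /= -> ->. Qed.
Lemma conj_real (a : R) : Num.conj (Complex a 0) = Complex a 0 :> C.
Proof. by apply: complex_eqP; rewrite ?Re_conj ?Im_conj //= oppr0. Qed.
Lemma half_complex : (2^-1 : C) = Complex (2^-1) 0.
Proof. by rewrite complexr0 fmorphV rmorph_nat. Qed.

Lemma adjE X i j : adj X i j = Num.conj (X j i).
Proof. by rewrite !mxE. Qed.
Lemma adjK X : adj (adj X) = X.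
Proof. by apply/matrixP => i j; rewrite !adjE conjCK. Qed.
Lemma adjD X Y : adj (X + Y) = adj X + adj Y.
Proof. by apply/matrixP => i j; rewrite [RHS]mxE !adjE -rmorphD mxE. Qed.
Lemma adjN X : adj (- X) = - adj X.
Proof. by apply/matrixP => i j; rewrite [RHS]mxE !adjE mxE rmorphN. Qed.
Lemma adjB X Y : adj (X - Y) = adj X - adj Y.
Proof. by rewrite adjD adjN. Qed.
Lemma adjM X Y : adj (X *m Y) = adj Y *m adj X.
Proof.
apply/matrixP => i j; rewrite adjE !mxE rmorph_sum; apply: eq_bigr => k _.
by rewrite !adjE rmorphM mulrC.
Qed.
Lemma adj_scale (a : R) X : adj (Complex a 0 *: X) = Complex a 0 *: adj X.
Proof. by apply/matrixP => i j; rewrite [RHS]mxE !adjE mxE rmorphM /=; congr (_ * _); exact: conj_real. Qed.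
Lemma adj_scalar (a : R) : adj (Complex a 0)%:M = (Complex a 0)%:M :> Mat.
Proof.
apply/matrixP => i j; rewrite adjE !mxE eq_sym.
by case: (i == j); rewrite ?mulr1n ?mulr0n ?conj_real // rmorph0.
Qed.
Lemma adj0 : adj 0 = 0 :> Mat.
Proof. by apply/matrixP => i j; rewrite adjE !mxE rmorph0. Qed.

Lemma ipE X Y : ip X Y = \sum_i \sum_j Re (X i j * Y j i).
Proof. by rewrite /ip mxtrace_mul2 Re_sum; apply: eq_bigr => i _; rewrite Re_sum. Qed.
Lemma ipC X Y : ip X Y = ip Y X.
Proof. by rewrite /ip mxtrace_mulC. Qed.
Lemma ipM X Y Z : ip (X *m Y) Z = ip X (Y *m Z).
Proof. by rewrite /ip mulmxA. Qed.
Lemma ipDl X Y Z : ip (X + Y) Z = ip X Z + ip Y Z.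
Proof. by rewrite /ip mulmxDl mxtraceD ReD. Qed.
Lemma ipDr X Y Z : ip Z (X + Y) = ip Z X + ip Z Y.
Proof. by rewrite ipC ipDl !(ipC Z). Qed.
Lemma ipNl X Z : ip (- X) Z = - ip X Z.
Proof. by rewrite /ip mulNmx raddfN /= ReN. Qed.
Lemma ipNr X Z : ip Z (- X) = - ip Z X.
Proof. by rewrite ipC ipNl (ipC Z). Qed.
Lemma ip0l Z : ip 0 Z = 0.
Proof. by rewrite /ip mul0mx mxtrace0. Qed.
Lemma ip0r Z : ip Z 0 = 0.
Proof. by rewrite ipC ip0l. Qed.
Lemma ipZl (a : R) X Z : ip (Complex a 0 *: X) Z = a * ip X Z.
Proof. by rewrite /ip -scalemxAl mxtraceZ ReM /= mul0r subr0. Qed.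
Lemma ipZr (a : R) X Z : ip Z (Complex a 0 *: X) = a * ip Z X.
Proof. by rewrite ipC ipZl (ipC Z). Qed.
Lemma ip_adj X Y : ip (adj X) (adj Y) = ip X Y.
Proof.
rewrite !ipE exchange_big /=; apply: eq_bigr => i _; apply: eq_bigr => j _.
by rewrite !adjE -rmorphM Re_conj.
Qed.

Lemma ip_adj_self X : ip X (adj X) = \sum_i \sum_j (Re (X i j) ^+ 2 + Im (X i j) ^+ 2).
Proof.
rewrite ipE; apply: eq_bigr => i _; apply: eq_bigr => j _.
by rewrite adjE ReM Re_conj Im_conj mulrN opprK !expr2.
Qed.

(** Although [ip] is indefinite, pairing with the adjoint gives the squared Frobenius norm;
    uniqueness of all gradients rests on this. *)
Lemma ip_adj_self_eq0 X : ip X (adj X) = 0 -> X = 0.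
Proof.
rewrite ip_adj_self => /eqP H; apply/matrixP => i j; rewrite mxE.
have P i' j' : 0 <= Re (X i' j') ^+ 2 + Im (X i' j') ^+ 2 by rewrite addr_ge0 ?sqr_ge0.
move: H; rewrite psumr_eq0 => [/allP /(_ i (mem_index_enum _)) /= H|k _]; last exact: sumr_ge0.
move: H; rewrite psumr_eq0 => [/allP /(_ j (mem_index_enum _)) /= H|//].
by move: H; rewrite paddr_eq0 ?sqr_ge0 // !sqrf_eq0 => /andP[/eqP a /eqP b]; apply: complex_eqP.
Qed.

Lemma half_double X : 2^-1 *: (X + X) = X :> Mat.
Proof.
have -> : X + X = 2 *: X by rewrite scaler_nat mulr2n.
by rewrite scalerA mulVf ?scale1r // pnatr_eq0.
Qed.

Lemma pminus_split X Y : is_herm X -> adj Y = - Y -> pminus (X + Y) = X.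
Proof.
move=> HX HY; rewrite /pminus adjD HX HY addrACA subrr addr0.
exact: half_double.
Qed.
Lemma pplus_split X Y : is_herm X -> adj Y = - Y -> pplus (X + Y) = Y.
Proof.
move=> HX HY; rewrite /pplus adjD HX HY opprD opprK addrACA subrr add0r.
exact: half_double.
Qed.
Lemma pminus_herm X : is_herm X -> pminus X = X.
Proof. by move=> HX; rewrite -[X in LHS]addr0 pminus_split // adj0 oppr0. Qed.
Lemma pplus_herm X : is_herm X -> pplus X = 0.
Proof. by move=> HX; rewrite -[X in LHS]addr0 pplus_split // adj0 oppr0. Qed.
Lemma is_herm_pminus X : is_herm (pminus X).
Proof. by rewrite /is_herm /pminus half_complex adj_scale adjD adjK addrC. Qed.
Lemma adj_pplus X : adj (pplus X) = - pplus X.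
Proof. by rewrite /pplus half_complex adj_scale adjB adjK -scalerN opprB. Qed.
Lemma pminus_pplus X : pminus X + pplus X = X.
Proof.
rewrite /pminus /pplus -scalerDr addrACA subrr addr0.
exact: half_double.
Qed.
Lemma pminusD X Y : pminus (X + Y) = pminus X + pminus Y.
Proof. by rewrite /pminus adjD addrACA scalerDr. Qed.
Lemma pminusZ (a : R) X : pminus (Complex a 0 *: X) = Complex a 0 *: pminus X.
Proof. by rewrite /pminus adj_scale -scalerDr !scalerA mulrC. Qed.

Lemma ip_pminus_pplus X Y : is_herm X -> adj Y = - Y -> ip X Y = 0.
Proof.
move=> HX HY; have := ip_adj X Y; rewrite HX HY ipNr.
by set t := ip X Y => H; lra.
Qed.

Lemma ip_pminusBpplus X Y :
  ip (pminus X) (pminus Y) - ip (pplus X) (pplus Y) = ip X (adj Y).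
Proof.
rewrite -{3}(pminus_pplus X) -{3}(pminus_pplus Y) adjD is_herm_pminus adj_pplus.
have H1 := ip_pminus_pplus (is_herm_pminus X) (adj_pplus Y).
have := ip_pminus_pplus (is_herm_pminus Y) (adj_pplus X); rewrite ipC => H2.
move: (pminus X) (pplus X) (pminus Y) (pplus Y) H1 H2 => a b c d H1 H2.
by rewrite ipDl !(ipDr c (- d)) !ipNr H1 H2 oppr0 addr0 add0r.
Qed.

(** The zero diagonal encodes that R(q) kills diagonals, so that [Rq] becomes a plain entrywise
    product. *)
Definition cothmx q (i j : 'I_n) : C := if i == j then 0 else Complex (coth (q 0 i - q 0 j)) 0.
(** Off the diagonal this is coth' = -1 / sinh^2 at q_i - q_j. *)
Definition sinhmx q (i j : 'I_n) : C := if i == j then 0 else 1 - cothmx q i j * cothmx q i j.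

Lemma RqE q X : Rq q X = hadamard (cothmx q) X.
Proof. by apply/matrixP => i j; rewrite !mxE /cothmx; case: eqP => _; rewrite ?mulr0. Qed.

Lemma conj_cothmx q i j : Num.conj (cothmx q i j) = cothmx q i j.
Proof. by rewrite /cothmx; case: eqP => _; rewrite ?rmorph0 //; exact: conj_real. Qed.

Lemma coth_odd (x : R) : coth (- x) = - coth x.
Proof. by rewrite /coth opprK -[X in _ / X]opprB invrN mulrN addrC. Qed.

Lemma cothmxC q i j : cothmx q j i = - cothmx q i j.
Proof.
rewrite /cothmx eq_sym; case: eqP => _; first by rewrite oppr0.
by rewrite -opprB coth_odd; apply: complex_eqP => //=; rewrite oppr0.
Qed.

Lemma cothmx0 q i : cothmx q i i = 0.
Proof. by rewrite /cothmx eqxx. Qed.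

Lemma sinhmxC q i j : sinhmx q j i = sinhmx q i j.
Proof. by rewrite /sinhmx eq_sym cothmxC mulrNN. Qed.

Lemma sinhmx0 q i : sinhmx q i i = 0.
Proof. by rewrite /sinhmx eqxx. Qed.

Lemma sinhmxE q i j : i != j -> sinhmx q i j = 1 - cothmx q i j * cothmx q i j.
Proof. by rewrite /sinhmx => /negbTE ->. Qed.

(** In the variables exp(2a) and exp(2b) coth is rational, so the three-term identity reduces to a
    field computation. *)
Lemma coth_sub (a b : R) : a - b != 0 ->
  expR a ^+ 2 - expR b ^+ 2 != 0 /\
  coth (a - b) = (expR a ^+ 2 + expR b ^+ 2) / (expR a ^+ 2 - expR b ^+ 2).
Proof.
move=> /expR_sub_neq0; rewrite /coth opprB !expRD !expRN.
have a0 : expR a != 0 by rewrite gt_eqF ?expR_gt0.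
have b0 : expR b != 0 by rewrite gt_eqF ?expR_gt0.
move: (expR a) (expR b) a0 b0 => u v u0 v0 H.
have E : u / v - v / u = (u ^+ 2 - v ^+ 2) / (u * v) by field; rewrite u0 v0.
have d0 : u ^+ 2 - v ^+ 2 != 0.
  by apply: contra_neq H => Z; rewrite E Z mul0r.
have E2 : u / v + v / u = (u ^+ 2 + v ^+ 2) / (u * v) by field; rewrite u0 v0.
by split=> //; rewrite E E2 invf_div mulrA mulfVK // mulf_neq0.
Qed.

Lemma cothmx_triple q i j l : Greg q -> i != j -> j != l -> l != i ->
  cothmx q i j * cothmx q j l + cothmx q j l * cothmx q l i + cothmx q l i * cothmx q i j = -1.
Proof.
move=> Gq ij jl li; rewrite /cothmx (negbTE ij) (negbTE jl) (negbTE li).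
have [d1 ->] := coth_sub (Greg_neq Gq ij).
have [d2 ->] := coth_sub (Greg_neq Gq jl).
have [d3 ->] := coth_sub (Greg_neq Gq li).
move: (expR _ ^+ 2) (expR _ ^+ 2) (expR _ ^+ 2) d1 d2 d3 => u v w d1 d2 d3.
apply: complex_eqP.
  rewrite !ReD !ReM ReN /= !mul0r !subr0.
  by field; rewrite d1 d2 d3.
by rewrite !ImD !ImM ImN /= !mul0r !mulr0 !addr0 oppr0.
Qed.

Lemma RqD q X Y : Rq q (X + Y) = Rq q X + Rq q Y.
Proof. by rewrite !RqE; apply/matrixP => i j; rewrite !mxE mulrDl. Qed.
Lemma RqN q X : Rq q (- X) = - Rq q X.
Proof. by rewrite !RqE; apply/matrixP => i j; rewrite !mxE mulNr. Qed.
Lemma RqZ q (a : C) X : Rq q (a *: X) = a *: Rq q X.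
Proof. by rewrite !RqE; apply/matrixP => i j; rewrite !mxE mulrA. Qed.
Lemma ip_Rq q X Y : ip (Rq q X) Y = - ip X (Rq q Y).
Proof.
rewrite !RqE !ipE -sumrN; apply: eq_bigr => i _; rewrite -sumrN; apply: eq_bigr => j _.
by rewrite !mxE (cothmxC q i j) -ReN; congr (Re _); ring.
Qed.
Lemma Rq_adj q X : Rq q (adj X) = - adj (Rq q X).
Proof.
rewrite !RqE; apply/matrixP => i j.
rewrite [LHS]mxE adjE [in RHS]mxE adjE mxE rmorphM (cothmxC q i j) rmorphN mulrN opprK.
by congr (_ * _); exact/esym/conj_cothmx.
Qed.

End TraceForm.

(** * Gradients by Riesz representation, and pullback from the Hermitian slice *)

Section Gradients.
Context {R : realType} {n : nat}.
Local Notation C := R[i].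
Local Notation Mat := 'M[C]_n.
Local Notation Qs := 'rV[R]_n.
Local Notation E := ('rV[R]_n * 'M[R]_n * 'M[R]_n)%type.
Implicit Types (q x : Qs) (X Y Z J : Mat) (f F : @MFun R n) (g : E -> R).
Local Notation Re := (@complex.Re R).
Local Notation Im := (@complex.Im R).

(** A value obtained by choice is identified through uniqueness: the adjoint of the difference of
    two representatives is itself a test direction in [S], and pairing with it gives the norm of
    that difference. *)
Lemma riesz_eq (S : Mat -> Prop) (D : Mat -> R) X :
  (forall Y Z, S Y -> S Z -> S (adj (Y - Z))) -> S X -> (forall Y, S Y -> ip X Y = D Y) ->
  riesz S D = X.
Proof.
move=> Sadj SX HX; rewrite /riesz.
set P := fun X' : Mat => _.
have [SZ HZ] : P (epsilon (inhabits 0) P) by apply: epsilon_spec; exists X.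
move: (epsilon _ P) SZ HZ => Z SZ HZ.
apply/eqP; rewrite -subr_eq0; apply/eqP; apply: ip_adj_self_eq0.
have Sd := Sadj Z X SZ SX.
by rewrite ipDl ipNl HZ // HX // subrr.
Qed.

Lemma is_hermD X Y : is_herm X -> is_herm Y -> is_herm (X + Y).
Proof. by rewrite /is_herm adjD => -> ->. Qed.
Lemma is_hermN X : is_herm X -> is_herm (- X).
Proof. by rewrite /is_herm adjN => ->. Qed.
Lemma is_hermZ (a : R) X : is_herm X -> is_herm (Complex a 0 *: X).
Proof. by rewrite /is_herm adj_scale => ->. Qed.
Lemma is_herm0 : is_herm (0 : Mat).
Proof. exact: adj0. Qed.

Lemma dpartD X Y : dpart (X + Y) = dpart X + dpart Y.
Proof. by apply/matrixP => i j; rewrite !mxE; case: eqP; rewrite ?addr0. Qed.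
Lemma dpartN X : dpart (- X) = - dpart X.
Proof. by apply/matrixP => i j; rewrite !mxE; case: eqP; rewrite ?oppr0. Qed.
Lemma is_diag_hermB X Y : is_diag_herm X -> is_diag_herm Y -> is_diag_herm (X - Y).
Proof.
move=> [X1 X2] [Y1 Y2]; split; first exact/is_hermD/is_hermN.
by rewrite dpartD dpartN X2 Y2.
Qed.

Lemma is_diag_herm_offdiag X : is_diag_herm X -> forall i j, i != j -> X i j = 0.
Proof. by move=> [_ <-] i j ij; rewrite mxE (negbTE ij). Qed.

Lemma ip_dpart X Y : is_diag_herm X -> ip X (dpart Y) = ip X Y.
Proof.
move=> HX; rewrite !ipE; apply: eq_bigr => i _; apply: eq_bigr => j _.
rewrite [dpart _ _ _]mxE eq_sym; have [->//|ij] := eqVneq i j.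
by rewrite (is_diag_herm_offdiag HX ij) mulr0 mul0r.
Qed.

Definition rpart X : 'M[R]_n := map_mx Re X.
Definition ipart X : 'M[R]_n := map_mx Im X.
Definition point q J : E := (q, rpart J, ipart J).

Lemma cplx_parts J : cplx (rpart J) (ipart J) = J.
Proof. by apply/matrixP => i j; rewrite !mxE; case: (J i j). Qed.

Lemma pointD q q' J J' : point (q + q') (J + J') = point q J + point q' J'.
Proof.
congr (_, _, _); apply/matrixP => i j; first by rewrite !mxE ReD.
by rewrite !mxE ImD.
Qed.

Lemma pointZ (t : R) q J : point (t *: q) (Complex t 0 *: J) = t *: point q J.
Proof.
congr (_, _, _); apply/matrixP => i j; first by rewrite !mxE ReM /= mul0r subr0.
by rewrite !mxE ImM /= mul0r addr0.
Qed.

Lemma lift_point f q J : Defs.lift f (point q J) = f q J.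
Proof. by rewrite /Defs.lift /= cplx_parts. Qed.

Lemma point_surj (p : E) : p = point p.1.1 (cplx p.1.2 p.2).
Proof.
case: p => [[q a] b] /=; congr (_, _, _); apply/matrixP => i j; by rewrite !mxE.
Qed.

Lemma dirD_line f q J x Y :
  dirD f q J x Y = derive1 (fun t : R => Defs.lift f (point q J + t *: point x Y)) 0.
Proof.
rewrite /dirD; congr (derive1 _ 0); apply/funext => t.
by rewrite -pointZ -pointD lift_point.
Qed.

Lemma dirD_derive f q J x Y : derivable (Defs.lift f) (point q J) (point x Y) ->
  dirD f q J x Y = 'D_(point x Y) (Defs.lift f) (point q J).
Proof. by rewrite dirD_line; exact: derive1_line. Qed.

Local Open Scope classical_set_scope.

Lemma Ereg_line (p v : E) : Ereg p ->
  \forall t \near (0 : R), Ereg (p + t *: v).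
Proof.
move=> Up; have N := open_nbhs_nbhs (conj (@open_Ereg R n) Up).
have [d d0 H] := near_square v 0 N.
near=> t.
have td : `|t| < d by near: t; exact: (@nbhs0_lt R R^o).
by have := H t td t 0 (lexx _); rewrite normr0 normr_ge0 scale0r addr0; apply.
Unshelve. all: by end_near.
Qed.

Local Open Scope ring_scope.

(** Near t = 0 the line stays regular and Hermitian, so tangential derivatives see only values on
    the slice. Independence of the extension starts here. *)
Lemma dirD_eqm f F q J x Y : eqm f F -> Greg q -> is_herm J -> is_herm Y ->
  dirD f q J x Y = dirD F q J x Y.
Proof.
move=> fF Gq HJ HY; rewrite /dirD !derive1E; apply: near_eq_derive.
have := @Ereg_line (point q J) (point x Y) Gq; apply: filterS => t.
by rewrite -pointZ -pointD => Ut; apply: fF => //; apply: is_hermD => //; exact: is_hermZ.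
Qed.

(** Re tr (X Y) pairs entry (i, j) with (j, i) and imaginary parts with a minus sign; hence the
    transposed indices and the sign. *)
Definition gradJ g (p : E) : Mat :=
  \matrix_(i, j) Complex ('D_(eA j i) g p) (- 'D_(eB j i) g p).
Definition gradq g (p : E) : Mat :=
  \matrix_(i, j) if i == j then Complex ('D_(eq_ i) g p) 0 else 0.

Lemma is_diag_herm_gradq g p : is_diag_herm (gradq g p).
Proof.
split; apply/matrixP => i j.
  rewrite adjE !mxE eq_sym; have [->|_] := eqVneq i j; last by rewrite rmorph0.
  exact: conj_real.
by rewrite !mxE; case: eqP.
Qed.

Lemma ip_gradq g p X : ip (gradq g p) X = \sum_k Re (X k k) * 'D_(eq_ k) g p.
Proof.
rewrite ipE; apply: eq_bigr => i _.
rewrite (bigD1 i) //= big1 ?addr0 => [|j ji].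
  by rewrite mxE eqxx ReM /= mul0r subr0 mulrC.
by rewrite mxE eq_sym (negbTE ji) mul0r.
Qed.

Lemma smooth_derive_point U g p x Y : open U -> smooth_on U g -> U p ->
  'D_(point x Y) g p = \sum_k x 0 k * 'D_(eq_ k) g p + ip (gradJ g p) Y.
Proof.
move=> Uo sg Up; rewrite (smooth_derive_sum _ _ _ Uo sg Up); congr (_ + _).
rewrite ipE [RHS]exchange_big /= -big_split /=; apply: eq_bigr => i _.
rewrite -big_split /=; apply: eq_bigr => j _.
rewrite !mxE ReM /= mulNr opprK.
by congr (_ + _); exact: mulrC.
Qed.

Lemma gradJ_eq U g p X : open U -> smooth_on U g -> U p ->
  (forall Y, ip X Y = 'D_(point 0 Y) g p) -> gradJ g p = X.
Proof.
move=> Uo sg Up HX; apply/eqP; rewrite -subr_eq0; apply/eqP/ip_adj_self_eq0.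
rewrite ipDl ipNl HX (smooth_derive_point _ _ Uo sg Up) [X in _ - (X + _)]big1 ?add0r ?subrr //.
by move=> k _; rewrite mxE mul0r.
Qed.

Lemma smooth_derive_diag U g p X : open U -> smooth_on U g -> U p ->
  'D_(point (diagvec X) 0) g p = ip (gradq g p) X.
Proof.
move=> Uo sg Up; rewrite (smooth_derive_point _ _ Uo sg Up) ip0r addr0 ip_gradq.
by apply: eq_bigr => k _; rewrite mxE.
Qed.

Definition ext_pminus F : @MFun R n := fun q J => F q (pminus J).

Lemma dirD_ext_pminus F q J x Y :
  dirD (ext_pminus F) q J x Y = dirD F q (pminus J) x (pminus Y).
Proof.
by rewrite /dirD; congr (derive1 _ 0); apply/funext => t; rewrite /ext_pminus pminusD pminusZ.
Qed.

Lemma ip_pminusl X Y : is_herm Y -> ip (pminus X) Y = ip X Y.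
Proof.
move=> HY; rewrite -{2}(pminus_pplus X) ipDl.
by rewrite [ip (pplus X) Y]ipC (ip_pminus_pplus HY (adj_pplus X)) addr0.
Qed.

Lemma ip_pminus_sym X Y : ip (pminus X) Y = ip X (pminus Y).
Proof.
rewrite ipC -(ip_pminusl Y (is_herm_pminus X)) ipC.
exact: ip_pminusl (is_herm_pminus Y).
Qed.

Definition slice_proj (p : E) : E := point p.1.1 (pminus (cplx p.1.2 p.2)).

Lemma slice_projD (p v : E) : slice_proj (p + v) = slice_proj p + slice_proj v.
Proof.
rewrite /slice_proj -pointD -pminusD; congr (point _ (pminus _)); apply/matrixP => i j.
by apply: complex_eqP; rewrite ?ReD ?ImD !mxE ?ReD ?ImD.
Qed.

Lemma slice_projZ (a : R) (v : E) : slice_proj (a *: v) = a *: slice_proj v.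
Proof.
rewrite /slice_proj -pointZ -pminusZ; congr (point _ (pminus _)); apply/matrixP => i j.
by apply: complex_eqP; rewrite !mxE ?ReM ?ImM /=; ring.
Qed.

Lemma slice_projK (p : E) : slice_proj (slice_proj p) = slice_proj p.
Proof. by rewrite /slice_proj /= cplx_parts pminus_herm //; exact: is_herm_pminus. Qed.

Lemma slice_proj_point q J : slice_proj (point q J) = point q (pminus J).
Proof. by rewrite /slice_proj /= cplx_parts. Qed.

Lemma ext_pminus_proj F (p : E) :
  Defs.lift (ext_pminus F) (slice_proj p) = Defs.lift (ext_pminus F) p.
Proof.
rewrite /slice_proj lift_point /Defs.lift /ext_pminus pminus_herm //.
exact: is_herm_pminus.
Qed.

(** Derivatives of a function invariant under the projection are again invariant, so they may be
    treated as slice functions in turn. *)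
Lemma derive_proj g (v p : E) : (forall y, g (slice_proj y) = g y) ->
  'D_v g (slice_proj p) = 'D_v g p.
Proof.
move=> Pg; rewrite /derive.
suff -> : (fun h : R => h^-1 *: ((g \o shift (slice_proj p)) (h *: v) - g (slice_proj p))) =
  (fun h : R => h^-1 *: ((g \o shift p) (h *: v) - g p)) by [].
apply/funext => h /=.
by rewrite Pg -[g (h *: v + slice_proj p)]Pg slice_projD slice_projK -slice_projD Pg.
Qed.

Lemma derive_proj_dir g (v p : E) : (forall y, g (slice_proj y) = g y) ->
  'D_(slice_proj v) g p = 'D_v g p.
Proof.
move=> Pg; rewrite /derive.
suff -> : (fun h : R => h^-1 *: ((g \o shift p) (h *: slice_proj v) - g p)) =
  (fun h : R => h^-1 *: ((g \o shift p) (h *: v) - g p)) by [].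
apply/funext => h /=.
rewrite -[g (h *: slice_proj v + p)]Pg slice_projD slice_projZ slice_projK.
by rewrite -slice_projZ -slice_projD Pg.
Qed.

(** Projecting the direction does not change the derivative, so the gradient represents the same
    functional as its Hermitian part. General [g] is allowed because derivatives of slice functions
    are also fed in. *)
Lemma is_herm_gradJ_proj g (p : E) : smooth_on (@Ereg R n) g -> Ereg p ->
  (forall y, g (slice_proj y) = g y) -> is_herm (gradJ g p).
Proof.
move=> sg Up Pg.
have D Y : ip (gradJ g p) Y = 'D_(point 0 Y) g p.
  rewrite (smooth_derive_point _ _ (@open_Ereg R n) sg Up) [X in _ = X + _]big1 ?add0r //.
  by move=> k _; rewrite mxE mul0r.
suff -> : gradJ g p = pminus (gradJ g p) by exact: is_herm_pminus.
apply: (gradJ_eq (@open_Ereg R n) sg Up) => Y.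
by rewrite ip_pminus_sym D -slice_proj_point derive_proj_dir.
Qed.

Section FunctionOnSlice.
Context (F : @MFun R n) (sF : smooth_on (@Ereg R n) (Defs.lift (ext_pminus F))).
Local Notation g := (Defs.lift (ext_pminus F)).

Lemma dirD_slice q J x Y : Greg q ->
  dirD F q (pminus J) x (pminus Y) = 'D_(point x Y) g (point q J).
Proof.
move=> Gq; rewrite -dirD_ext_pminus; apply: dirD_derive.
have Up : Ereg (point q J) := Gq.
exact: smooth_derivable sF Up.
Qed.

Lemma dirD_slice_herm q J x Y : Greg q -> is_herm J -> is_herm Y ->
  dirD F q J x Y = 'D_(point x Y) g (point q J).
Proof. by move=> Gq HJ HY; rewrite -dirD_slice // !pminus_herm. Qed.

Lemma is_herm_gradJ q J : Greg q -> is_herm (gradJ g (point q J)).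
Proof. by move=> Gq; apply: (is_herm_gradJ_proj sF) => // p; exact: ext_pminus_proj. Qed.

Lemma d2m_slice q J : Greg q -> d2m F q (pminus J) = gradJ g (point q J).
Proof.
move=> Gq; apply: riesz_eq; last 1 first.
- move=> Y HY; have := dirD_slice J 0 Y Gq; rewrite (pminus_herm HY) => ->.
  have Up : Ereg (point q J) := Gq.
  rewrite (smooth_derive_point _ _ (@open_Ereg R n) sF Up) [X in _ = X + _]big1 ?add0r //.
  by move=> k _; rewrite mxE mul0r.
- by move=> Y Z HY HZ; rewrite /is_herm adjK (is_hermD HY (is_hermN HZ)).
- exact: is_herm_gradJ.
Qed.

Lemma nabla1_slice q J : Greg q -> nabla1 F q (pminus J) = gradq g (point q J).
Proof.
move=> Gq; apply: riesz_eq; last 1 first.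
- move=> Y HY; have := dirD_slice J (diagvec Y) 0 Gq; rewrite (pminus_herm is_herm0) => ->.
  have Up : Ereg (point q J) := Gq.
  by rewrite (smooth_derive_diag _ (@open_Ereg R n) sF Up).
- by move=> Y Z HY HZ; have H := is_diag_hermB HY HZ; have [-> _] := H.
- exact: is_diag_herm_gradq.
Qed.

Lemma d2m_herm q J : Greg q -> is_herm J -> d2m F q J = gradJ g (point q J).
Proof. by move=> Gq HJ; rewrite -d2m_slice // pminus_herm. Qed.

Lemma nabla1_herm q J : Greg q -> is_herm J -> nabla1 F q J = gradq g (point q J).
Proof. by move=> Gq HJ; rewrite -nabla1_slice // pminus_herm. Qed.

End FunctionOnSlice.

Lemma riesz_ext (S : Mat -> Prop) (D D' : Mat -> R) :
  (forall Y, S Y -> D Y = D' Y) -> riesz S D = riesz S D'.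
Proof.
move=> DD; rewrite /riesz; congr (epsilon _ _); apply/funext => X; apply/propext.
by split=> -[SX H]; split=> // Y SY; rewrite H // DD.
Qed.

Lemma nabla1_eqm f F q J : eqm f F -> Greg q -> is_herm J -> nabla1 f q J = nabla1 F q J.
Proof. by move=> fF Gq HJ; apply: riesz_ext => Y _; exact: dirD_eqm is_herm0. Qed.

Lemma d2m_eqm f F q J : eqm f F -> Greg q -> is_herm J -> d2m f q J = d2m F q J.
Proof. by move=> fF Gq HJ; apply: riesz_ext => Y HY; exact: dirD_eqm. Qed.

Section SmoothFunction.
Context (f : @MFun R n) (sf : smooth_on (@Ereg R n) (Defs.lift f)).

Lemma d2_gradJ q J : Greg q -> d2 f q J = gradJ (Defs.lift f) (point q J).
Proof.
move=> Gq; have Up : Ereg (point q J) := Gq.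
apply: riesz_eq => // Y _; rewrite dirD_derive; last exact: smooth_derivable sf Up.
rewrite (smooth_derive_point _ _ (@open_Ereg R n) sf Up) [X in _ = X + _]big1 ?add0r //.
by move=> k _; rewrite mxE mul0r.
Qed.

(** Hermitian test directions are orthogonal to the anti-Hermitian part of [d2 f]. *)
Lemma d2m_pminus_d2 q J : Greg q -> is_herm J -> d2m f q J = pminus (d2 f q J).
Proof.
move=> Gq HJ; have Up : Ereg (point q J) := Gq.
apply: riesz_eq; last 1 first.
- move=> Y HY; rewrite ip_pminusl // d2_gradJ // dirD_derive; last exact: smooth_derivable sf Up.
  rewrite (smooth_derive_point _ _ (@open_Ereg R n) sf Up) [X in _ = X + _]big1 ?add0r //.
  by move=> k _; rewrite mxE mul0r.
- by move=> Y Z HY HZ; rewrite /is_herm adjK (is_hermD HY (is_hermN HZ)).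
- exact: is_herm_pminus.
Qed.

Lemma is_diag_herm_nabla1 q J : Greg q -> is_diag_herm (nabla1 f q J).
Proof.
move=> Gq; have Up : Ereg (point q J) := Gq.
suff -> : nabla1 f q J = gradq (Defs.lift f) (point q J) by exact: is_diag_herm_gradq.
apply: riesz_eq; last 1 first.
- move=> Y HY; rewrite dirD_derive; last exact: smooth_derivable sf Up.
  by rewrite (smooth_derive_diag _ (@open_Ereg R n) sf Up).
- by move=> Y Z HY HZ; have H := is_diag_hermB HY HZ; have [-> _] := H.
- exact: is_diag_herm_gradq.
Qed.

End SmoothFunction.

End Gradients.

(** * The reduced brackets at Hermitian J *)

Section RestrictionFormulas.
Context {R : realType} {n : nat}.
Local Notation C := R[i].
Local Notation Mat := 'M[C]_n.
Implicit Types (q : 'rV[R]_n) (X Y Z J a b df dh N : Mat).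

Lemma ip_bracket1 q J a b :
  ip (Rq q (a *m J - J *m a)) b - ip (Rq q (b *m J - J *m b)) a =
  ip J (comm (Rq q a) b + comm a (Rq q b)).
Proof. exact: (@tr_bracket1 R Mat ip (Rq q) ipC ipM ipDl ipNl (ip_Rq q)). Qed.

Lemma ip_bracket2 q X Y :
  ip (Rq q (adj X - X)) (Y + adj Y) - ip (Rq q (adj Y - Y)) (X + adj X) = 4 * ip X (Rq q Y).
Proof.
exact: (@tr_bracket2 R Mat ip adj (Rq q) ipC ipDl ipNl ip_adj (RqD q) (RqN q) (ip_Rq q)
  (Rq_adj q)).
Qed.

Lemma adj_commr X J : is_herm J -> adj X = - X -> is_herm (comm X J).
Proof.
move=> HJ HX; rewrite /is_herm /comm adjB !adjM HJ HX.
by rewrite mulmxN mulNmx opprK addrC.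
Qed.

Lemma adj_comm_herm X J : is_herm J -> is_herm X -> adj (comm X J) = - comm X J.
Proof. by move=> HJ HX; rewrite /comm adjB !adjM HJ HX opprB. Qed.

Lemma comm_split X J : comm X J = comm (pplus X) J + comm (pminus X) J.
Proof.
rewrite /comm -{1 2}(pminus_pplus X); move: (pplus X) (pminus X) => u v.
by rewrite mulmxDl mulmxDr opprD addrACA addrC.
Qed.

(** A commutator with Hermitian [J] exchanges the two types of matrices, so the transverse part of a
    gradient drops out of the R(q) terms. *)
Lemma pplus_comm X J : is_herm J -> pplus (comm X J) = comm (pminus X) J.
Proof.
move=> HJ; rewrite comm_split pplus_split //; first exact/adj_commr/adj_pplus.
by apply: adj_comm_herm => //; exact: is_herm_pminus.
Qed.

Lemma pminus_anticomm X J : is_herm J ->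
  pminus (J *m X + X *m J) = J *m pminus X + pminus X *m J.
Proof.
move=> HJ; have Hu := is_herm_pminus X; have Hv := adj_pplus X.
rewrite -{1 2}(pminus_pplus X); move: (pminus X) (pplus X) Hu Hv => u v Hu Hv.
rewrite (mulmxDl u v J) (mulmxDr J u v) addrACA pminus_split //.
  by rewrite /is_herm adjD !adjM HJ Hu addrC.
by rewrite adjD !adjM HJ Hv mulNmx mulmxN -opprD addrC.
Qed.

Lemma br1_restriction q J df dh N (N' : Mat) :
  is_herm J -> is_diag_herm N -> is_diag_herm N' ->
  ip N (dpart (pminus dh)) - ip N' (dpart (pminus df))
  + ip (Rq q (pplus (comm df J))) (pminus dh)
  - ip (Rq q (pplus (comm dh J))) (pminus df)
  + ip (pplus J) (comm (pminus df) (pminus dh) - comm (pplus df) (pplus dh)) =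
  ip N (pminus dh) - ip N' (pminus df)
  + ip J (comm (Rq q (pminus df)) (pminus dh) + comm (pminus df) (Rq q (pminus dh))).
Proof.
move=> HJ HN HN'; rewrite !ip_dpart // !pplus_comm // (pplus_herm HJ) ip0l addr0.
by rewrite -ip_bracket1 addrA.
Qed.

Lemma ip_diag_anticomm N J X : is_diag_herm N -> is_herm J -> is_herm X ->
  ip N (J *m X + X *m J) = 2 * ip N (J *m X).
Proof.
move=> [HN _] HJ HX; rewrite ipDr.
have <- : ip N (J *m X) = ip N (X *m J) by rewrite -ip_adj adjM HN HJ HX.
by rewrite mulr2n mulrDl mul1r.
Qed.

Let pm_arith (r s t u : R) : r - s = t - u -> r + u - t - s = 0.
Proof. by move=> H; lra. Qed.

(** The four terms form two differences of the type <A^-, B^-> - <A^+, B^+> = <A, adj B>; by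
    cyclicity both are Re tr (J X J Z) with Z = adj Y. *)
Lemma ip_pm_cancel J X Y : is_herm J ->
  ip (pminus (J *m X)) (pminus (Y *m J)) + ip (pplus (X *m J)) (pplus (J *m Y))
  - ip (pminus (X *m J)) (pminus (J *m Y)) - ip (pplus (J *m X)) (pplus (Y *m J)) = 0.
Proof.
move=> HJ; have H1 := ip_pminusBpplus (J *m X) (Y *m J).
have H2 := ip_pminusBpplus (X *m J) (J *m Y).
have E : ip (J *m X) (adj (Y *m J)) = ip (X *m J) (adj (J *m Y)).
  by rewrite !adjM HJ ipC ipM ipC ipM [RHS]ipC ipM !mulmxA.
by rewrite E -H2 in H1; exact: pm_arith H1.
Qed.

Let br2_arith (a1 a2 t1 t2 p1 p2 p3 p4 r : R) : t1 - t2 = 4 * r ->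
  p1 + p2 - p3 - p4 = 0 ->
  2^-1 * (2 * a1 - 2 * a2 + t1 - t2 + p1 + p2 - p3 - p4) = a1 - a2 + 2 * r.
Proof. by move=> H1 H2; lra. Qed.

Lemma br2_restriction q J df dh N (N' : Mat) :
  is_herm J -> is_diag_herm N -> is_diag_herm N' ->
  2^-1 * (
    ip N (dpart (pminus (J *m dh + dh *m J)))
  - ip N' (dpart (pminus (J *m df + df *m J)))
  + ip (Rq q (pplus (comm df J))) (pminus (J *m dh + dh *m J))
  - ip (Rq q (pplus (comm dh J))) (pminus (J *m df + df *m J))
  + ip (pminus (J *m df)) (pminus (dh *m J)) + ip (pplus (df *m J)) (pplus (J *m dh))
  - ip (pminus (df *m J)) (pminus (J *m dh)) - ip (pplus (J *m df)) (pplus (dh *m J))) =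
  ip N (J *m pminus dh) - ip N' (J *m pminus df)
  + 2 * ip (J *m pminus df) (Rq q (J *m pminus dh)).
Proof.
move=> HJ HN HN'; have Z := ip_pm_cancel df dh HJ.
rewrite !ip_dpart // !pplus_comm // !pminus_anticomm //.
have := is_herm_pminus df; have := is_herm_pminus dh.
move: (pminus df) (pminus dh) => a b Hb Ha.
rewrite (ip_diag_anticomm HN HJ Hb) (ip_diag_anticomm HN' HJ Ha).
have := ip_bracket2 q (J *m a) (J *m b); rewrite !adjM HJ Ha Hb -/(comm a J) -/(comm b J).
move=> H; exact: br2_arith H Z.
Qed.

Lemma restriction_formulas (F H f h : @MFun R n) q J :
  smooth_on (@Ereg R n) (Defs.lift f) -> smooth_on (@Ereg R n) (Defs.lift h) ->
  extends f F -> extends h H -> Greg q -> is_herm J ->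
  br1 f h q J = br1m F H q J /\ br2 f h q J = br2m F H q J.
Proof.
move=> sf sh fF hH Gq HJ.
have DF : d2m F q J = pminus (d2 f q J).
  by rewrite -(d2m_eqm fF Gq HJ); exact: d2m_pminus_d2.
have DH : d2m H q J = pminus (d2 h q J).
  by rewrite -(d2m_eqm hH Gq HJ); exact: d2m_pminus_d2.
have Nf := is_diag_herm_nabla1 sf J Gq; have Nh := is_diag_herm_nabla1 sh J Gq.
have EF := nabla1_eqm fF Gq HJ; have EH := nabla1_eqm hH Gq HJ.
rewrite /br1 /br2 /br1m /br2m /nabla2m /nabla2 /nabla2' DF DH -EF -EH.
by split; [exact: br1_restriction|exact: br2_restriction].
Qed.

End RestrictionFormulas.

(** * The slice brackets of invariant smooth functions are invariant and smooth *)

Section BracketsAreInvariantSmooth.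
Context {R : realType} {n : nat}.
Local Notation C := R[i].
Local Notation Mat := 'M[C]_n.
Local Notation E := ('rV[R]_n * 'M[R]_n * 'M[R]_n)%type.
Local Notation U := (@Ereg R n).
Implicit Types (q x : 'rV[R]_n) (X Y Z J D N M : Mat) (F G : @MFun R n) (A B : E -> Mat).
Local Notation Re := (@complex.Re R).
Local Notation Im := (@complex.Im R).

Definition sclosC (z : E -> C) := sclos U (fun p => Re (z p)) /\ sclos U (fun p => Im (z p)).
Definition sclosM A := forall i j, sclosC (fun p => A p i j).

Lemma sclosC_add z w : sclosC z -> sclosC w -> sclosC (fun p => z p + w p).
Proof.
move=> [z1 z2] [w1 w2]; split.
  by apply: sclos_ext (sclos_add z1 w1) _ => p _; rewrite ReD.
by apply: sclos_ext (sclos_add z2 w2) _ => p _; rewrite ImD.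
Qed.

Lemma sclosC_mul z w : sclosC z -> sclosC w -> sclosC (fun p => z p * w p).
Proof.
move=> [z1 z2] [w1 w2]; split.
  by apply: sclos_ext (sclos_sub (sclos_mul z1 w1) (sclos_mul z2 w2)) _ => p _; rewrite ReM.
by apply: sclos_ext (sclos_add (sclos_mul z1 w2) (sclos_mul z2 w1)) _ => p _; rewrite ImM.
Qed.

Lemma sclosC_cst c : sclosC (fun=> c).
Proof. by split; exact: sclos_cst. Qed.

Lemma sclosC_ext z w : sclosC z -> (forall p, z p = w p) -> sclosC w.
Proof. by move=> H zw; suff <- : z = w by []; exact/funext. Qed.

Lemma sclosC_sum I (r : seq I) (P : pred I) (z : I -> E -> C) :
  (forall i, sclosC (z i)) -> sclosC (fun p => \sum_(i <- r | P i) z i p).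
Proof.
move=> H; split.
  by apply: sclos_ext (sclos_sum r P (fun i => (H i).1)) _ => p _; rewrite Re_sum.
by apply: sclos_ext (sclos_sum r P (fun i => (H i).2)) _ => p _; rewrite Im_sum.
Qed.

Lemma sclosM_add A B : sclosM A -> sclosM B -> sclosM (fun p => A p + B p).
Proof.
by move=> HA HB i j; apply: sclosC_ext (sclosC_add (HA i j) (HB i j)) _ => p; rewrite mxE.
Qed.

Lemma sclosM_mul A B : sclosM A -> sclosM B -> sclosM (fun p => A p *m B p).
Proof.
move=> HA HB i j.
have H := sclosC_sum (index_enum _) xpredT (fun k => sclosC_mul (HA i k) (HB k j)).
by apply: sclosC_ext H _ => p; rewrite mxE.
Qed.

Lemma sclosM_scale c A : sclosM A -> sclosM (fun p => c *: A p).
Proof.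
by move=> HA i j; apply: sclosC_ext (sclosC_mul (sclosC_cst c) (HA i j)) _ => p; rewrite mxE.
Qed.

Lemma sclosM_opp A : sclosM A -> sclosM (fun p => - A p).
Proof.
by move=> HA i j; apply: sclosC_ext (sclosM_scale (-1) HA i j) _ => p; rewrite scaleN1r.
Qed.

Lemma sclosM_adj A : sclosM A -> sclosM (fun p => adj (A p)).
Proof.
move=> HA i j; have [H1 H2] := HA j i; split.
  by apply: sclos_ext H1 _ => p _; rewrite adjE Re_conj.
by apply: sclos_ext (sclos_opp H2) _ => p _; rewrite adjE Im_conj.
Qed.

Lemma sclosM_Rq A : sclosM A -> sclosM (fun p => Rq p.1.1 (A p)).
Proof.
move=> HA i j; have [<-|ij] := eqVneq i j.
  by apply: sclosC_ext (sclosC_cst 0) _ => p; rewrite mxE eqxx.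
have Hc : sclosC (fun p : E => Complex (coth (p.1.1 0 i - p.1.1 0 j)) 0).
  by split; [exact: sclos_coth|exact: sclos_cst].
by apply: sclosC_ext (sclosC_mul (HA i j) Hc) _ => p; rewrite mxE (negbTE ij).
Qed.

Lemma sclos_ip A B : sclosM A -> sclosM B -> sclos U (fun p => ip (A p) (B p)).
Proof.
move=> HA HB; have := sclosC_sum (index_enum _) xpredT (fun i => sclosM_mul HA HB i i).
by case.
Qed.

Lemma sclosM_pminus A : sclosM A -> sclosM (fun p => pminus (A p)).
Proof. by move=> HA; exact: sclosM_scale (sclosM_add HA (sclosM_adj HA)). Qed.

Lemma sclosM_cplx : sclosM (fun p => cplx p.1.2 p.2).
Proof.
move=> i j; split; first by apply: sclos_ext (sclos_A i j) _ => p _; rewrite mxE.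
by apply: sclos_ext (sclos_B i j) _ => p _; rewrite mxE.
Qed.

Lemma sclosM_gradJ g : smooth_on U g -> sclosM (gradJ g).
Proof.
move=> sg i j; split.
  by apply: sclos_ext (sclos_smooth (smooth_on_derive (eA j i) sg)) _ => p _; rewrite mxE.
apply: sclos_ext (sclos_opp (sclos_smooth (smooth_on_derive (eB j i) sg))) _ => p _.
by rewrite mxE.
Qed.

Lemma sclosM_gradq g : smooth_on U g -> sclosM (gradq g).
Proof.
move=> sg i j; have [<-|ij] := eqVneq i j; last first.
  by apply: sclosC_ext (sclosC_cst 0) _ => p; rewrite mxE (negbTE ij).
split; last by apply: sclos_ext (sclos_cst U 0) _ => p _; rewrite mxE eqxx.
apply: sclos_ext (sclos_smooth (smooth_on_derive (eq_ i) sg)) _ => p _.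
by rewrite mxE eqxx.
Qed.

(** Here and in [bform2] the gradients are plain matrix arguments and [M] stands for J, so that
    gradients can be differentiated separately and [M] shifted. *)
Definition bform1 q M N D (N' D' : Mat) : R :=
  ip N D' - ip N' D + ip M (comm (Rq q D) D' + comm D (Rq q D')).
Definition bform2 q M N D (N' D' : Mat) : R :=
  ip N (M *m D') - ip N' (M *m D) + 2 * ip (M *m D) (Rq q (M *m D')).

Lemma br1mE F G q J :
  br1m F G q J = bform1 q J (nabla1 F q J) (d2m F q J) (nabla1 G q J) (d2m G q J).
Proof. by []. Qed.
Lemma br2mE F G q J :
  br2m F G q J = bform2 q J (nabla1 F q J) (d2m F q J) (nabla1 G q J) (d2m G q J).
Proof. by []. Qed.

Lemma sclosM_comm A B : sclosM A -> sclosM B -> sclosM (fun p => comm (A p) (B p)).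
Proof. by move=> HA HB; apply: sclosM_add (sclosM_mul HA HB) (sclosM_opp (sclosM_mul HB HA)). Qed.

Section Closure.
Context (M N D N' D' : E -> Mat) (HM : sclosM M) (HN : sclosM N) (HD : sclosM D)
  (HN' : sclosM N') (HD' : sclosM D').

Lemma sclos_bform1 : sclos U (fun p => bform1 p.1.1 (M p) (N p) (D p) (N' p) (D' p)).
Proof.
apply: sclos_add (sclos_sub (sclos_ip HN HD') (sclos_ip HN' HD)) _; apply: sclos_ip => //.
apply: sclosM_add.
  by apply: sclosM_comm => //; exact: sclosM_Rq.
by apply: sclosM_comm => //; exact: sclosM_Rq.
Qed.

Lemma sclos_bform2 : sclos U (fun p => bform2 p.1.1 (M p) (N p) (D p) (N' p) (D' p)).
Proof.
have H1 := sclosM_mul HM HD; have H2 := sclosM_mul HM HD'.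
apply: sclos_add (sclos_sub (sclos_ip HN H2) (sclos_ip HN' H1)) _.
by apply: sclos_mul (sclos_cst _ _) _; apply: sclos_ip => //; exact: sclosM_Rq.
Qed.
End Closure.

(** At regular points the chosen [nabla1] and [d2m] are the smooth matrices [gradq] and [gradJ],
    which puts the bracket into the closure class. *)
Lemma smooth_br1m F G : SIm F -> SIm G -> smooth_on U (Defs.lift (ext_pminus (br1m F G))).
Proof.
move=> [sF _] [sG _]; apply: sclos_smooth_on; first exact: open_Ereg.
have HM := sclosM_pminus sclosM_cplx.
apply: sclos_ext (sclos_bform1 HM (sclosM_gradq sF) (sclosM_gradJ sF) (sclosM_gradq sG)
   (sclosM_gradJ sG)) _ => p Up.
rewrite /Defs.lift /ext_pminus br1mE.
rewrite (nabla1_slice sF _ Up) (nabla1_slice sG _ Up) (d2m_slice sF _ Up) (d2m_slice sG _ Up).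
by rewrite -point_surj.
Qed.

Lemma smooth_br2m F G : SIm F -> SIm G -> smooth_on U (Defs.lift (ext_pminus (br2m F G))).
Proof.
move=> [sF _] [sG _]; apply: sclos_smooth_on; first exact: open_Ereg.
have HM := sclosM_pminus sclosM_cplx.
apply: sclos_ext (sclos_bform2 HM (sclosM_gradq sF) (sclosM_gradJ sF) (sclosM_gradq sG)
   (sclosM_gradJ sG)) _ => p Up.
rewrite /Defs.lift /ext_pminus br2mE.
rewrite (nabla1_slice sF _ Up) (nabla1_slice sG _ Up) (d2m_slice sF _ Up) (d2m_slice sG _ Up).
by rewrite -point_surj.
Qed.

Section TorusAction.
Context (t : 'I_n -> C) (ut : unit_diag t).

Lemma conjtD X Y : conjt t (X + Y) = conjt t X + conjt t Y.
Proof. by apply/matrixP => i j; rewrite !mxE mulrDr mulrDl. Qed.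
Lemma conjtN X : conjt t (- X) = - conjt t X.
Proof. by apply/matrixP => i j; rewrite !mxE mulrN mulNr. Qed.
Lemma conjtZ (c : C) X : conjt t (c *: X) = c *: conjt t X.
Proof. by apply/matrixP => i j; rewrite !mxE; ring. Qed.
Lemma conjtM X Y : conjt t (X *m Y) = conjt t X *m conjt t Y.
Proof.
apply/matrixP => i j; rewrite !mxE mulr_sumr mulr_suml; apply: eq_bigr => k _.
rewrite !mxE -[X in X = _]mul1r -(ut k).
by move: (t i) (t k) (Num.conj _) (Num.conj _) => *; ring.
Qed.
Lemma conjt_Rq q X : Rq q (conjt t X) = conjt t (Rq q X).
Proof.
apply/matrixP => i j; rewrite !mxE; case: eqP => _; first by rewrite mulr0 mul0r.
by move: (Complex _ _) => c; ring.
Qed.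
Lemma conjt_adj X : adj (conjt t X) = conjt t (adj X).
Proof.
apply/matrixP => i j; rewrite adjE !mxE !rmorphM /= conjCK.
by rewrite mulrC [_ * Num.conj (X j i)]mulrC mulrA.
Qed.
Lemma conjt_trace X : \tr (conjt t X) = \tr X.
Proof. by apply: eq_bigr => i _; rewrite mxE mulrAC ut mul1r. Qed.
Lemma ip_conjt X Y : ip (conjt t X) (conjt t Y) = ip X Y.
Proof. by rewrite /ip -conjtM conjt_trace. Qed.
Lemma conjt_diag X : is_diag_herm X -> conjt t X = X.
Proof.
move=> HX; apply/matrixP => i j; rewrite mxE.
have [<-|ij] := eqVneq i j; first by rewrite mulrAC ut mul1r.
by rewrite (is_diag_herm_offdiag HX ij) mulr0 mul0r.
Qed.
Lemma conjt_herm X : is_herm X -> is_herm (conjt t X).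
Proof. by rewrite /is_herm conjt_adj => ->. Qed.

(** Torus conjugation is a trace-preserving algebra automorphism that commutes with R(q) and fixes
    diagonal matrices, so it can be pulled out of every pairing. *)
Lemma bform1_conjt q M N D (N' D' : Mat) : is_diag_herm N -> is_diag_herm N' ->
  bform1 q (conjt t M) N (conjt t D) N' (conjt t D') = bform1 q M N D N' D'.
Proof.
move=> HN HN'; rewrite /bform1 /comm !conjt_Rq -!conjtM -!conjtN -!conjtD.
by rewrite -{1}(conjt_diag HN) -{1}(conjt_diag HN') !ip_conjt.
Qed.
Lemma bform2_conjt q M N D (N' D' : Mat) : is_diag_herm N -> is_diag_herm N' ->
  bform2 q (conjt t M) N (conjt t D) N' (conjt t D') = bform2 q M N D N' D'.
Proof.
move=> HN HN'; rewrite /bform2 -!conjtM !conjt_Rq.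
by rewrite -{1}(conjt_diag HN) -{1}(conjt_diag HN') !ip_conjt.
Qed.
End TorusAction.

Lemma conjt_conjK (t : 'I_n -> C) X : unit_diag t -> conjt t (conjt (fun k => Num.conj (t k)) X) = X.
Proof.
move=> ut; apply/matrixP => i j; rewrite !mxE conjCK !mulrA ut mul1r -mulrA.
by rewrite ut mulr1.
Qed.

Section Equivariance.
Context (F : @MFun R n) (HF : SIm F) (t : 'I_n -> C) (ut : unit_diag t).

Lemma dirD_conjt q J x Y : Greg q -> is_herm J -> is_herm Y ->
  dirD F q (conjt t J) x (conjt t Y) = dirD F q J x Y.
Proof.
move=> Gq HJ HY; have [_ iF] := HF.
have -> : dirD F q (conjt t J) x (conjt t Y) = dirD (fun q J => F q (conjt t J)) q J x Y.
  by rewrite /dirD; congr (derive1 _ 0); apply/funext => s; rewrite conjtD conjtZ.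
by apply: dirD_eqm => // q' J' Gq' HJ'; exact: iF.
Qed.

Lemma d2m_conjt q J : Greg q -> is_herm J -> d2m F q (conjt t J) = conjt t (d2m F q J).
Proof.
move=> Gq HJ; have [sF _] := HF; have Up : Ereg (point q J) := Gq.
apply: riesz_eq; last 1 first.
(* Conjugating back by the inverse torus element reduces the test direction to one at [J]. *)
- move=> Y HY; pose Y' := conjt (fun k => Num.conj (t k)) Y.
  have EY : Y = conjt t Y' by rewrite conjt_conjK.
  have HY' : is_herm Y' by apply: conjt_herm HY.
  rewrite EY ip_conjt // dirD_conjt // (d2m_herm sF) // (dirD_slice_herm sF) //.
  rewrite (smooth_derive_point _ _ (@open_Ereg R n) sF Up) [X in _ = X + _]big1 ?add0r //.
  by move=> k _; rewrite mxE mul0r.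
- by move=> Y Z HY HZ; rewrite /is_herm adjK (is_hermD HY (is_hermN HZ)).
- by apply: conjt_herm; rewrite (d2m_herm sF) //; exact: is_herm_gradJ.
Qed.

Lemma nabla1_conjt q J : Greg q -> is_herm J -> nabla1 F q (conjt t J) = nabla1 F q J.
Proof.
move=> Gq HJ; apply: riesz_ext => X _.
rewrite -[in RHS](dirD_conjt _ Gq HJ is_herm0); congr (dirD _ _ _ _ _).
by apply/matrixP => i j; rewrite !mxE mulr0 mul0r.
Qed.
End Equivariance.

Lemma SIm_br1m F G : SIm F -> SIm G -> SIm (br1m F G).
Proof.
move=> HF HG; split; first exact: smooth_br1m.
move=> q J t Gq HJ ut; rewrite !br1mE !d2m_conjt // !nabla1_conjt //.
rewrite bform1_conjt // (nabla1_herm HF.1, nabla1_herm HG.1) //; exact: is_diag_herm_gradq.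
Qed.

Lemma SIm_br2m F G : SIm F -> SIm G -> SIm (br2m F G).
Proof.
move=> HF HG; split; first exact: smooth_br2m.
move=> q J t Gq HJ ut; rewrite !br2mE !d2m_conjt // !nabla1_conjt //.
rewrite bform2_conjt // (nabla1_herm HF.1, nabla1_herm HG.1) //; exact: is_diag_herm_gradq.
Qed.

End BracketsAreInvariantSmooth.

(** * Infinitesimal torus invariance *)

Section TorusMoment.
Context {R : realType} {n : nat}.
Local Notation C := R[i].
Local Notation Mat := 'M[C]_n.
Local Notation E := ('rV[R]_n * 'M[R]_n * 'M[R]_n)%type.
Local Notation U := (@Ereg R n).
Local Notation Re := (@complex.Re R).
Local Notation Im := (@complex.Im R).
Local Open Scope classical_set_scope.

(* With [b r = 2 r / (1 + r^2)], [a r = - r b r] the curve leaves [p] in the direction [u];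
   two applications of the mean value theorem give [D_u g (p + c u) = r D_v g (p')]. *)
Lemma derive_circle_eq0 (W : set E) g (p u v : E) : open W -> smooth_on W g -> W p ->
  (forall r : R, g (p + (2 * r / (1 + r ^+ 2)) *: u + (- r * (2 * r / (1 + r ^+ 2))) *: v) = g p) ->
  'D_u g p = 0.
Proof.
move=> Wo sg Wp H; apply/eqP; rewrite -normr_le0; apply/ler_addgt0Pr => e e0; rewrite add0r.
have Wn := open_nbhs_nbhs (conj Wo Wp).
have cu : \forall y \near p, `|'D_u g p - 'D_u g y| < e / 2.
  have e20 : 0 < e / 2 by rewrite divr_gt0.
  have c : {for p, continuous ('D_u g)} := (smooth_on_derive u sg [::] Wp).1.
  by move/cvgrPdist_lt : c; apply.
have cv : \forall y \near p, `|'D_v g p - 'D_v g y| < 1.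
  have c : {for p, continuous ('D_v g)} := (smooth_on_derive v sg [::] Wp).1.
  by move/cvgrPdist_lt : c; apply.
have [d d0 N] := near_square u v (filterI Wn (filterI cu cv)).
set K := `|'D_v g p| + 1; have K0 : 0 < K by rewrite ltr_wpDl.
(* For r < m these bounds give r < 1, b <= 2 r < d, and r K < e / 2, where K bounds ['D_v g] near
   [p]. *)
pose m := Num.min (Num.min 1 (d / 2)) (e / (2 * K)).
have m0 : 0 < m by rewrite !lt_min ltr01 !divr_gt0 // mulr_gt0.
pose r := m / 2; have r0 : 0 < r by rewrite divr_gt0.
have rm : r < m by rewrite ltr_pdivrMr // ltr_pMr // ltr1n.
have [r1 [rd re]] : r < 1 /\ r < d / 2 /\ r < e / (2 * K).
  by move: rm; rewrite !lt_min -andbA => /and3P[].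
have q1 : 1 <= 1 + r ^+ 2 by rewrite lerDl sqr_ge0.
have q0 : 0 < 1 + r ^+ 2 by apply: lt_le_trans q1.
set b := 2 * r / (1 + r ^+ 2).
have b0 : 0 < b by rewrite divr_gt0 // mulr_gt0.
have bd : b < d.
  apply: le_lt_trans (_ : 2 * r < d); last by rewrite mulrC -ltr_pdivlMr.
  by rewrite ler_pdivrMr // ler_peMr // ltW // mulr_gt0.
have nb : `|b| = b by rewrite gtr0_norm.
have bd' : `|b| < d by rewrite nb.
have rb : `|- r * b| <= `|b|.
  by rewrite normrM normrN nb (gtr0_norm r0) ler_piMl ?ltW.
have z0 : `|0 : R| <= `|b| by rewrite normr0.
have [|c1 c1b E1] := @MVT_line R _ g p u b.
  move=> s sb; have [Ws _] := N b bd' s 0 sb z0.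
  by move: Ws; rewrite scale0r addr0 => Ws; exact: smooth_derivable sg Ws.
have [|c2 c2b E2] := @MVT_line R _ g (p + b *: u) v (- r * b).
  move=> s sb; have [Ws _] := N b bd' b s (lexx _) (le_trans sb rb).
  exact: smooth_derivable sg Ws.
have [_ [_ V2]] := N b bd' b c2 (lexx _) (le_trans c2b rb).
have [_ [V1 _]] := N b bd' c1 0 c1b z0; rewrite scale0r addr0 in V1.
have := H r; rewrite -/b => Hr; rewrite Hr in E2.
move: E1 E2 V1 V2; set x := 'D_u g (p + c1 *: u).
set y := 'D_v g (p + b *: u + c2 *: v); set D := 'D_u g p; set D' := 'D_v g p.
move=> E1 E2 V1 V2.
have xy : x = r * y.
  have : b * (x - r * y) = 0 by move: E1 E2; clear; move: (g _) (g _) => s t; lra.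
  by move/eqP; rewrite mulf_eq0 gt_eqF //= subr_eq0 => /eqP.
have yK : `|y| <= K.
  rewrite -[y](subrK D') -[y - D']opprB addrC; apply: le_trans (ler_normD _ _) _.
  by rewrite lerD // normrN ltW.
rewrite -[D](subrK x) [e]splitr; apply: le_trans (ler_normD _ _) _.
apply: lerD; first exact: ltW.
rewrite xy normrM (gtr0_norm r0); apply: le_trans (ler_wpM2l (ltW r0) yK) _.
by rewrite -ler_pdivlMr // -mulrA -invfM ltW.
Qed.

Local Open Scope ring_scope.

(** The rational parametrization of the circle: the sine is b and the cosine minus 1 is - r b,
    exactly the coefficients of the curve in [derive_circle_eq0]. *)
Definition rot (k : 'I_n) (r : R) (l : 'I_n) : C :=
  if l == k then Complex ((1 - r ^+ 2) / (1 + r ^+ 2)) (2 * r / (1 + r ^+ 2)) else 1.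

Lemma unit_diag_rot k r : unit_diag (rot k r).
Proof.
move=> l; rewrite /rot; case: eqP => _; last by rewrite rmorph1 mulr1.
have q0 : 1 + r ^+ 2 != 0 by rewrite gt_eqF // ltr_pwDl // sqr_ge0.
apply: complex_eqP; rewrite ?ReM ?ImM ?Re_conj ?Im_conj /=; by field.
Qed.

(** This is the commutator of i E_kk with J, the velocity of rotating the k-th phase. *)
Definition rot_gen (k : 'I_n) (J : Mat) : Mat :=
  \matrix_(a, b) (J a b * (if a == k then (if b == k then 0 else Complex 0 1)
     else (if b == k then Complex 0 (-1) else 0))).
Definition rot_gen2 (k : 'I_n) (J : Mat) : Mat :=
  \matrix_(a, b) (J a b * (if a == k then (if b == k then 0 else 1)
     else (if b == k then 1 else 0))).

Lemma conjt_rot k r (J : Mat) : conjt (rot k r) J =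
  J + Complex (2 * r / (1 + r ^+ 2)) 0 *: rot_gen k J
  + Complex (- r * (2 * r / (1 + r ^+ 2))) 0 *: rot_gen2 k J.
Proof.
have q0 : 1 + r ^+ 2 != 0 by rewrite gt_eqF // ltr_pwDl // sqr_ge0.
apply/matrixP => a b; rewrite !mxE.
have Hu := unit_diag_rot k r k; rewrite /rot eqxx in Hu.
rewrite /rot; case: (eqVneq a k) => ak; case: (eqVneq b k) => bk.
- by rewrite mulrAC Hu; ring.
- by rewrite rmorph1; apply: complex_eqP; rewrite !(ReD, ImD, ReM, ImM) /=; field.
- by apply: complex_eqP; rewrite !(ReD, ImD, ReM, ImM, Re_conj, Im_conj) /=; field.
- by rewrite rmorph1; ring.
Qed.

(** Cyclicity gives Re of i ((J D)_kk - (D J)_kk), and for Hermitian factors the second entry is the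
    conjugate of the first. *)
Lemma ip_rot_gen k D J : is_herm D -> is_herm J -> ip D (rot_gen k J) = - 2 * Im ((J *m D) k k).
Proof.
move=> HD HJ; rewrite ipE mxE Im_sum mulr_sumr.
have T a b : Re (D a b * rot_gen k J b a) =
    (if b == k then - Im (J k a * D a k) else 0) + (if a == k then - Im (J k b * D b k) else 0).
  have HDb : D k b = Num.conj (D b k) by rewrite -adjE HD.
  have HJb : J b k = Num.conj (J k b) by rewrite -adjE HJ.
  rewrite [rot_gen _ _ _ _]mxE; have [->|bk] := eqVneq b k; have [->|ak] := eqVneq a k.
  - have DR : Im (D k k) = 0.
      have := congr1 Im (congr1 (fun X : Mat => X k k) HD).
      by rewrite adjE Im_conj => H; lra.
    have JR : Im (J k k) = 0.
      have := congr1 Im (congr1 (fun X : Mat => X k k) HJ).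
      by rewrite adjE Im_conj => H; lra.
    by rewrite !mulr0 ImM DR JR !(mulr0, mul0r) addr0 oppr0 addr0.
  - by rewrite addr0 !(ReM, ImM) /=; ring.
  - by rewrite add0r HDb HJb !(ReM, ImM, Re_conj, Im_conj) /=; ring.
  - by rewrite !mulr0 addr0.
under eq_bigr => a _ do (under eq_bigr => b _ do rewrite T).
under eq_bigr => a _ do rewrite big_split /= -big_mkcond big_pred1_eq.
rewrite big_split /= -exchange_big /=.
under [X in _ + X]eq_bigr => a _ do rewrite -big_mkcond big_pred1_eq.
by rewrite -big_split /=; apply: eq_bigr => a _; ring.
Qed.

(** The derivative along the orbit of the k-th phase vanishes. This is needed because q' sees only
    real parts of the diagonal, whereas the Yang-Baxter identity involves the complex diagonal. *)
Lemma moment_real (F : @MFun R n) q J k : SIm F -> Greg q -> is_herm J ->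
  Im ((J *m gradJ (Defs.lift (ext_pminus F)) (point q J)) k k) = 0.
Proof.
move=> [sF iF] Gq HJ; set g := Defs.lift _.
have Up : U (point q J) := Gq.
have HD := is_herm_gradJ sF J Gq.
suff : ip (gradJ g (point q J)) (rot_gen k J) = 0 by rewrite (ip_rot_gen k HD HJ) -/g => H; lra.
have -> : ip (gradJ g (point q J)) (rot_gen k J) = 'D_(point 0 (rot_gen k J)) g (point q J).
  rewrite (smooth_derive_point _ _ (@open_Ereg R n) sF Up) [X in _ = X + _]big1 ?add0r //.
  by move=> l _; rewrite mxE mul0r.
apply: (@derive_circle_eq0 U g (point q J) _ (point 0 (rot_gen2 k J)) (@open_Ereg R n) sF Up) => r.
rewrite -!pointZ -!pointD -conjt_rot !scaler0 !addr0 /g !lift_point /ext_pminus.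
have ut := unit_diag_rot k r.
by rewrite !pminus_herm ?iF //; exact: conjt_herm.
Qed.

End TorusMoment.

(** * Differentiating brackets along a fixed direction *)

Section JacobiIdentity.
Context {R : realType} {n : nat}.
Local Notation C := R[i].
Local Notation Mat := 'M[C]_n.
Local Notation E := ('rV[R]_n * 'M[R]_n * 'M[R]_n)%type.
Local Notation U := (@Ereg R n).
Local Notation Re := (@complex.Re R).
Local Notation Im := (@complex.Im R).
Implicit Types (q x : 'rV[R]_n) (X Y Z J D N M : Mat) (F G H : @MFun R n) (A B : E -> Mat).

Lemma is_derive_congr (V : normedModType R) (p v : V) (f g : V -> R) (df dg : R) :
  is_derive p v f df -> (forall y, f y = g y) -> df = dg -> is_derive p v g dg.
Proof. by move=> H fg <-; have <- : f = g by exact/funext. Qed.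

Section DirectionalCalculus.
Context (p v : E).

Definition isDC (z : E -> C) (z' : C) :=
  is_derive p v (fun y => Re (z y)) (Re z') /\ is_derive p v (fun y => Im (z y)) (Im z').
Definition isDM A (A' : Mat) := forall i j, isDC (fun y => A y i j) (A' i j).

Lemma isDC_ext z w z' w' : isDC z z' -> (forall y, z y = w y) -> z' = w' -> isDC w w'.
Proof. by move=> H zw <-; have <- : z = w by exact/funext. Qed.

Lemma isDC_cst c : isDC (fun=> c) 0.
Proof. by split; exact: is_derive_cst. Qed.

Lemma isDC_add z w z' w' : isDC z z' -> isDC w w' -> isDC (fun y => z y + w y) (z' + w').
Proof.
move=> [z1 z2] [w1 w2]; split.
  by apply: is_derive_congr (is_deriveD z1 w1) _ _ => [y|]; rewrite ReD.
by apply: is_derive_congr (is_deriveD z2 w2) _ _ => [y|]; rewrite ImD.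
Qed.

Lemma isDC_mul z w z' w' : isDC z z' -> isDC w w' ->
  isDC (fun y => z y * w y) (z' * w p + z p * w').
Proof.
move=> [z1 z2] [w1 w2]; split.
  apply: is_derive_congr (is_deriveB (is_deriveM z1 w1) (is_deriveM z2 w2)) _ _ => [y|].
    by rewrite ReM.
  by rewrite /GRing.scale /= ReD !ReM; ring.
apply: is_derive_congr (is_deriveD (is_deriveM z1 w2) (is_deriveM z2 w1)) _ _ => [y|].
  by rewrite ImM.
by rewrite /GRing.scale /= ImD !ImM; ring.
Qed.

Lemma isDC_sum I (r : seq I) (P : pred I) (z : I -> E -> C) (z' : I -> C) :
  (forall i, isDC (z i) (z' i)) ->
  isDC (fun y => \sum_(i <- r | P i) z i y) (\sum_(i <- r | P i) z' i).
Proof.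
move=> H; elim: r => [|i r IH].
  by apply: isDC_ext (isDC_cst 0) _ _ => [y|]; rewrite big_nil.
have [Pi|Pi] := boolP (P i).
  by apply: isDC_ext (isDC_add (H i) IH) _ _ => [y|]; rewrite big_cons Pi.
by apply: isDC_ext IH _ _ => [y|]; rewrite big_cons (negbTE Pi).
Qed.

Lemma isDM_mul A B (A' B' : Mat) : isDM A A' -> isDM B B' ->
  isDM (fun y => A y *m B y) (A' *m B p + A p *m B').
Proof.
move=> HA HB i j.
have H := isDC_sum (index_enum _) xpredT (fun k => isDC_mul (HA i k) (HB k j)).
by apply: isDC_ext H _ _ => [y|]; rewrite !mxE // big_split.
Qed.

Lemma is_derive_ip A B (A' B' : Mat) : isDM A A' -> isDM B B' ->
  is_derive p v (fun y => ip (A y) (B y)) (ip A' (B p) + ip (A p) B').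
Proof.
move=> HA HB.
have [H _] := isDC_sum (index_enum _) xpredT (fun k => isDM_mul HA HB k k).
by apply: is_derive_congr H _ _ => //; rewrite /ip -ReD -mxtraceD.
Qed.

Lemma is_derive_coth (y : R) : y != 0 -> is_derive y 1 coth (1 - coth y * coth y).
Proof.
move=> y0; have d0 := expR_sub_neq0 y0.
have He : is_derive y 1 expR (expR y) := is_derive_expR y.
have Hm : is_derive y 1 (fun t => expR (- t)) (- expR (- y)).
  have Hn : is_derive y 1 -%R (- 1 : R) := is_deriveNid y 1.
  by have := is_derive1_comp (is_derive_expR (- y)) Hn; rewrite mulrN1.
have HD : is_derive y 1 (fun t => expR t + expR (- t)) (expR y - expR (- y)).
  exact: is_derive_congr (is_deriveD He Hm) (fun=> erefl) erefl.
have HB : is_derive y 1 (fun t => expR t - expR (- t)) (expR y - - expR (- y)).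
  exact: is_derive_congr (is_deriveB He Hm) (fun=> erefl) erefl.
have HV : is_derive y 1 (fun t => (expR t - expR (- t))^-1)
    (- ((expR y - expR (- y)) ^- 2) * (expR y - - expR (- y))).
  case: HB => H1 H2; apply: DeriveDef.
    exact: (@derivableV R R (fun t => expR t - expR (- t)) y 1 d0 H1).
  by rewrite (@deriveV R R (fun t => expR t - expR (- t)) y 1 d0 H1) H2.
apply: (is_derive_congr (is_deriveM HD HV)) => [//|].
rewrite /coth /GRing.scale /=; move: d0.
by move: (expR y) (expR (- y)) => s t d0; field.
Qed.

Lemma isDC_cothmx i j : U p ->
  isDC (fun y => cothmx y.1.1 i j) (sinhmx p.1.1 i j * Complex (v.1.1 0 i - v.1.1 0 j) 0).
Proof.
move=> Up; rewrite /sinhmx /cothmx; have [_|ij] := eqVneq i j.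
  by rewrite mul0r; exact: isDC_cst.
split; last by apply: is_derive_congr (is_derive_cst 0 p v) _ _ => //; rewrite ImM ImD ImN ImM /=; ring.
have y0 := Greg_neq Up ij.
have Hl : is_derive p v (fun y : E => y.1.1 0 i - y.1.1 0 j) (v.1.1 0 i - v.1.1 0 j).
  by apply: (@is_derive_linear R n (fun y : E => y.1.1 0 i - y.1.1 0 j)) => [u w|a w];
    rewrite !mxE; ring.
have Hl' := (is_derive_line0 (fun y : E => y.1.1 0 i - y.1.1 0 j) p v _).1 Hl.
have E0 : (p + 0 *: v).1.1 0 i - (p + 0 *: v).1.1 0 j = p.1.1 0 i - p.1.1 0 j.
  by rewrite (scale0r v) (addr0 p).
have Hc := is_derive_coth y0; rewrite -E0 in Hc.
have := @is_derive1_comp R coth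
  (fun t : R => (p + t *: v).1.1 0 i - (p + t *: v).1.1 0 j) 0 _ _ Hc Hl'.
rewrite E0 => Hr.
have := (is_derive_line0 (fun y : E => coth (y.1.1 0 i - y.1.1 0 j)) p v _).2 Hr.
move=> /is_derive_congr; apply => //.
by rewrite !(ReM, ReD, ReN, ImM) /=; ring.
Qed.

Definition Rq_dot q x X : Mat :=
  \matrix_(i, j) (X i j * (sinhmx q i j * Complex (x 0 i - x 0 j) 0)).

Lemma isDM_Rq A (A' : Mat) : U p -> isDM A A' ->
  isDM (fun y => Rq y.1.1 (A y)) (Rq p.1.1 A' + Rq_dot p.1.1 v.1.1 (A p)).
Proof.
move=> Up HA i j; apply: isDC_ext (isDC_mul (HA i j) (isDC_cothmx i j Up)) _ _ => [y|].
  by rewrite RqE mxE.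
by rewrite RqE !mxE.
Qed.

(** The product rule is grouped so that the first two summands are again brackets, with one pair of
    gradients differentiated; the rest is the explicit dependence on M and q. *)
Lemma is_derive_bform2 (M N D N1 D1 : E -> Mat) (M' N' D' N1' D1' : Mat) : U p ->
  isDM M M' -> isDM N N' -> isDM D D' -> isDM N1 N1' -> isDM D1 D1' ->
  is_derive p v (fun y : E => bform2 y.1.1 (M y) (N y) (D y) (N1 y) (D1 y))
   (bform2 p.1.1 (M p) N' D' (N1 p) (D1 p) + bform2 p.1.1 (M p) (N p) (D p) N1' D1' +
    (ip (N p) (M' *m D1 p) - ip (N1 p) (M' *m D p) +
      2 * (ip (M' *m D p) (Rq p.1.1 (M p *m D1 p))
        + ip (M p *m D p) (Rq_dot p.1.1 v.1.1 (M p *m D1 p))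
        + ip (M p *m D p) (Rq p.1.1 (M' *m D1 p))))).
Proof.
move=> Up HM HN HD HN1 HD1.
have H1 := is_derive_ip HN (isDM_mul HM HD1).
have H2 := is_derive_ip HN1 (isDM_mul HM HD).
have H3 := is_derive_ip (isDM_mul HM HD) (isDM_Rq Up (isDM_mul HM HD1)).
have H4 := is_deriveZ 2 H3.
apply: is_derive_congr (is_deriveD (is_deriveB H1 H2) H4) _ _ => [y|]; first by [].
rewrite /bform2 /GRing.scale /= RqD !ipDr !ipDl.
by ring.
Qed.

Definition Mshift (l : R) (y : E) : Mat := pminus (cplx y.1.2 y.2) + (Complex l 0)%:M.

Lemma isDM_Mshift l : isDM (Mshift l) (pminus (cplx v.1.2 v.2)).
Proof.
pose L (y : E) : Mat := pminus (cplx y.1.2 y.2).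
have LD u w : L (u + w) = L u + L w.
  rewrite /L -pminusD; congr pminus; apply/matrixP => i j.
  by apply: complex_eqP; rewrite ?ReD ?ImD !mxE ?ReD ?ImD.
have LZ a w : L (a *: w) = Complex a 0 *: L w.
  rewrite /L -pminusZ; congr pminus; apply/matrixP => i j.
  by apply: complex_eqP; rewrite !mxE ?ReM ?ImM /=; ring.
move=> i j; rewrite -[X in isDC _ X]addr0.
apply: isDC_ext (isDC_add (_ : isDC (fun y => L y i j) _) (isDC_cst ((Complex l 0)%:M i j))) _ _.
- split.
    apply: (@is_derive_linear R n (fun y => Re (L y i j))) => [u w|a w].
      by rewrite LD mxE ReD.
    by rewrite LZ mxE ReM /=; ring.
  apply: (@is_derive_linear R n (fun y => Im (L y i j))) => [u w|a w].
    by rewrite LD mxE ImD.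
  by rewrite LZ mxE ImM /=; ring.
- by move=> y; rewrite /Mshift [RHS]mxE.
- by [].
Qed.

(** By Schwarz the variation of a gradient is itself a gradient, so it can be inserted into a
    bracket again. *)
Lemma isDM_gradJ g : smooth_on U g -> U p -> isDM (gradJ g) (gradJ ('D_v g) p).
Proof.
move=> sg Up i j; split.
  apply: (@is_derive_congr _ p v ('D_(eA j i) g) _ ('D_v ('D_(eA j i) g) p)).
  - by apply: DeriveDef => //; exact: smooth_derivable (smooth_on_derive _ sg) Up.
  - by move=> y; rewrite mxE.
  - by rewrite mxE; exact: (smooth_schwarz _ _ (@open_Ereg R n) sg Up).
have Hd : is_derive p v ('D_(eB j i) g) ('D_v ('D_(eB j i) g) p).
  by apply: DeriveDef => //; exact: smooth_derivable (smooth_on_derive _ sg) Up.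
apply: (is_derive_congr (is_deriveN Hd)) => [y|]; first by rewrite mxE.
by rewrite mxE /= (smooth_schwarz _ _ (@open_Ereg R n) sg Up).
Qed.

Lemma isDM_gradq g : smooth_on U g -> U p -> isDM (gradq g) (gradq ('D_v g) p).
Proof.
move=> sg Up i j; have [<-|ij] := eqVneq i j; last first.
  by apply: isDC_ext (isDC_cst 0) _ _ => [y|]; rewrite mxE (negbTE ij).
split; last by apply: is_derive_congr (is_derive_cst 0 p v) _ _ => [y|]; rewrite mxE eqxx.
apply: (@is_derive_congr _ p v ('D_(eq_ i) g) _ ('D_v ('D_(eq_ i) g) p)).
- by apply: DeriveDef => //; exact: smooth_derivable (smooth_on_derive _ sg) Up.
- by move=> y; rewrite mxE eqxx.
- by rewrite mxE eqxx; exact: (smooth_schwarz _ _ (@open_Ereg R n) sg Up).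
Qed.

End DirectionalCalculus.

End JacobiIdentity.

(** * The shifted bracket and its Hamiltonian vector fields *)

Section Hamiltonian.
Context {R : realType} {n : nat}.
Local Notation C := R[i].
Local Notation Mat := 'M[C]_n.
Local Notation E := ('rV[R]_n * 'M[R]_n * 'M[R]_n)%type.
Local Notation U := (@Ereg R n).
Local Notation Re := (@complex.Re R).
Local Notation Im := (@complex.Im R).
Implicit Types (q x : 'rV[R]_n) (X Y Z J D N M : Mat) (F G H : @MFun R n).

Lemma bform2_shift q (l : R) J N D N1 D1 : is_herm J -> is_herm D -> is_herm D1 ->
  bform2 q (J + (Complex l 0)%:M) N D N1 D1 = bform2 q J N D N1 D1 + l * bform1 q J N D N1 D1.
Proof.
move=> HJ HD HD1; rewrite /bform1 /bform2 /comm.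
rewrite (@tr_pencil R Mat ip adj (Rq q) ipC ipM ipDl ipNl ip_adj adjM (ip_Rq q) (Rq_adj q)) //.
have Z := @tr_K_herm R Mat ip adj (Rq q) ipC ipNl ip_adj (Rq_adj q) D D1 HD HD1.
rewrite !mulmxDl !mul_scalar_mx RqD RqZ !(ipDl, ipDr) !(ipZl, ipZr) Z.
by ring.
Qed.

Definition hamA q M N D : Mat := 2^-1 *: N - Rq q (M *m D).
Definition hamJ q M N D : Mat := hamA q M N D *m M + M *m adj (hamA q M N D).
Definition hamq M D : 'rV[R]_n := diagvec (- (M *m D)).

Lemma is_herm_hamJ q M N D : is_herm M -> is_herm (hamJ q M N D).
Proof. by move=> HM; rewrite /is_herm adjD !adjM adjK HM addrC. Qed.

Lemma half_halfD X : 2^-1 *: X + 2^-1 *: X = X :> Mat.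
Proof. by rewrite -scalerDr half_double. Qed.

Lemma bform2_ham q M N D N1 D1 : is_herm M -> is_herm D1 ->
  bform2 q M N D N1 D1 = ip N1 (- (M *m D)) + ip D1 (hamJ q M N D).
Proof.
move=> HM HD1.
have := @tr_hamiltonian R Mat ip adj (Rq q) ipC ipM ipDl ipNl ip_adj adjM (ip_Rq q) M
  (2^-1 *: N) (M *m D) D1 HM HD1.
rewrite half_halfD => <-; rewrite /bform2 ipNr.
by ring.
Qed.

Lemma bform2C q M N D N1 D1 : bform2 q M N D N1 D1 = - bform2 q M N1 D1 N D.
Proof.
rewrite /bform2 (ipC (M *m D)) ip_Rq; ring.
Qed.

(** [diagvec] discards imaginary parts while [hadamard_dot] keeps them; reality of the moment
    reconciles the flow of q with the algebraic identity. *)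
Lemma Rq_dot_hadamard q (L : Mat) X : (forall k, Im (L k k) = 0) ->
  Rq_dot q (diagvec (- L)) X = hadamard_dot (sinhmx q) L X.
Proof.
move=> HL; apply/matrixP => i j; rewrite !mxE; congr (_ * (_ * _)).
apply: complex_eqP; first by rewrite /= ReD !ReN; ring.
by rewrite ImD ImN !HL /=; ring.
Qed.

(** The adjoint reverses the alternating word, and a cyclic rotation brings it back with the first
    two blocks exchanged. This annihilates the right side of [mxtrace_schouten]. *)
Lemma ip_herm_triple M D1 D2 D3 : is_herm M -> is_herm D1 -> is_herm D2 -> is_herm D3 ->
  ip (M *m D1 *m (M *m D2)) (M *m D3) = ip (M *m D2 *m (M *m D1)) (M *m D3).
Proof.
move=> HM H1 H2 H3; rewrite -ip_adj !adjM HM H1 H2 H3 /ip !mulmxA.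
by rewrite [in LHS]mxtrace_mulC !mulmxA.
Qed.

Lemma ip_schouten q M D1 D2 D3 : Greg q ->
  is_herm M -> is_herm D1 -> is_herm D2 -> is_herm D3 ->
  (forall k, Im ((M *m D1) k k) = 0) -> (forall k, Im ((M *m D2) k k) = 0) ->
  (forall k, Im ((M *m D3) k k) = 0) ->
  let K := Rq q in let L1 := M *m D1 in let L2 := M *m D2 in let L3 := M *m D3 in
  ip (K L2 *m K L1 - K L1 *m K L2) L3 + ip (K L3 *m K L2 - K L2 *m K L3) L1
  + ip (K L1 *m K L3 - K L3 *m K L1) L2 + (ip L2 (Rq_dot q (hamq M D1) L3)
  + ip L3 (Rq_dot q (hamq M D2) L1) + ip L1 (Rq_dot q (hamq M D3) L2)) = 0.
Proof.
move=> Gq HM H1 H2 H3 I1 I2 I3 K L1 L2 L3.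
have T := ip_herm_triple HM H1 H2 H3.
rewrite /hamq !Rq_dot_hadamard // /K !RqE -/L1 -/L2 -/L3 !addrA.
have := mxtrace_schouten (cothmxC q) (cothmx0 q) (sinhmxC q) (sinhmx0 q) (sinhmxE q)
  (fun i j l => cothmx_triple Gq) L1 L2 L3.
move=> /(congr1 Re); rewrite !ReD ReN => HS.
apply: etrans HS _; rewrite -/(ip (L1 *m L2) L3) -/(ip (L2 *m L1) L3).
by rewrite T subrr.
Qed.

Lemma ham_jacobi q M N1 N2 N3 D1 D2 D3 : Greg q ->
  is_herm M -> is_herm D1 -> is_herm D2 -> is_herm D3 ->
  is_diag_herm N1 -> is_diag_herm N2 -> is_diag_herm N3 ->
  (forall k, Im ((M *m D1) k k) = 0) -> (forall k, Im ((M *m D2) k k) = 0) ->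
  (forall k, Im ((M *m D3) k k) = 0) ->
  let expl N2 N3 D2 D3 Y x := ip N2 (Y *m D3) - ip N3 (Y *m D2) +
    2 * (ip (Y *m D2) (Rq q (M *m D3)) + ip (M *m D2) (Rq_dot q x (M *m D3))
      + ip (M *m D2) (Rq q (Y *m D3))) in
  expl N2 N3 D2 D3 (hamJ q M N1 D1) (hamq M D1) +
  expl N3 N1 D3 D1 (hamJ q M N2 D2) (hamq M D2) +
  expl N1 N2 D1 D2 (hamJ q M N3 D3) (hamq M D3) = 0.
Proof.
move=> Gq HM H1 H2 H3 E1 E2 E3 I1 I2 I3 expl.
have HP N i j : is_diag_herm N -> i != j -> (2^-1 *: N) i j = 0.
  by move=> HN ij; rewrite mxE (is_diag_herm_offdiag HN ij) mulr0.
have S := ip_schouten Gq HM H1 H2 H3 I1 I2 I3.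
have Z (P : Mat) X Y : (forall i j, i != j -> P i j = 0) ->
    ip P (Rq q X *m Y - Y *m Rq q X + (X *m Rq q Y - Rq q Y *m X)) = 0.
  by move=> HP'; rewrite /ip !RqE mxtrace_diag_hadamard //; exact: cothmxC.
have P1 i j := @HP N1 i j E1; have P2 i j := @HP N2 i j E2; have P3 i j := @HP N3 i j E3.
(* The diagonal halves N_i / 2 are added to the Yang-Baxter identity for R(q) (M D_i). *)
have Sh := @tr_diagonal_shift R Mat ip ipC ipM ipDl ipNl _ _ _ _ _ _ _ _ _ _
  (diag_mx_comm P2 P1) (diag_mx_comm P3 P2) (diag_mx_comm P1 P3)
  (Z _ _ _ P1) (Z _ _ _ P2) (Z _ _ _ P3) S.
rewrite !addrA in Sh.
have := @tr_jacobi R Mat ip adj (Rq q) ipC ipM ipDl ipNl ip_adj adjK adjM (ip_Rq q) M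
  (2^-1 *: N1) (2^-1 *: N2) (2^-1 *: N3) D1 D2 D3 (Rq_dot q (hamq M D1))
  (Rq_dot q (hamq M D2)) (Rq_dot q (hamq M D3)) HM H1 H2 H3 Sh.
by rewrite !half_halfD.
Qed.

End Hamiltonian.

(** * The pencil: closure, bilinearity, antisymmetry and Leibniz rule *)

Section PoissonStructure.
Context {R : realType} {n : nat}.
Local Notation C := R[i].
Local Notation Mat := 'M[C]_n.
Local Notation E := ('rV[R]_n * 'M[R]_n * 'M[R]_n)%type.
Local Notation U := (@Ereg R n).
Local Notation Re := (@complex.Re R).
Local Notation Im := (@complex.Im R).
Implicit Types (q x : 'rV[R]_n) (X Y Z J D N M : Mat) (F G H K : @MFun R n) (a b l : R).
Local Notation slice F := (Defs.lift (ext_pminus F)).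

Definition pencil a b F G : @MFun R n := fadd (fscale a (br1m F G)) (fscale b (br2m F G)).

Lemma SIm_fadd F G : SIm F -> SIm G -> SIm (fadd F G).
Proof.
move=> [sF iF] [sG iG]; split; last by move=> q J t Gq HJ ut; rewrite /fadd iF ?iG.
apply: sclos_smooth_on; first exact: open_Ereg.
exact: sclos_ext (sclos_add (sclos_smooth sF) (sclos_smooth sG)) (fun=> fun=> erefl).
Qed.

Lemma SIm_fmul F G : SIm F -> SIm G -> SIm (fmul F G).
Proof.
move=> [sF iF] [sG iG]; split; last by move=> q J t Gq HJ ut; rewrite /fmul iF ?iG.
apply: sclos_smooth_on; first exact: open_Ereg.
exact: sclos_ext (sclos_mul (sclos_smooth sF) (sclos_smooth sG)) (fun=> fun=> erefl).
Qed.

Lemma SIm_fscale a F : SIm F -> SIm (fscale a F).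
Proof.
move=> [sF iF]; split; last by move=> q J t Gq HJ ut; rewrite /fscale iF.
apply: sclos_smooth_on; first exact: open_Ereg.
exact: sclos_ext (sclos_mul (sclos_cst U a) (sclos_smooth sF)) (fun=> fun=> erefl).
Qed.

Lemma SIm_pencil a b F G : SIm F -> SIm G -> SIm (pencil a b F G).
Proof.
by move=> HF HG; apply: SIm_fadd; apply: SIm_fscale; [exact: SIm_br1m|exact: SIm_br2m].
Qed.

Section PointValues.
Context (q : 'rV[R]_n) (J : Mat) (Gq : Greg q) (HJ : is_herm J).
Let p := point q J.
Let Up : U p := Gq.

Lemma gradJ_herm F : SIm F -> is_herm (gradJ (slice F) p).
Proof. by move=> [sF _]; exact: is_herm_gradJ. Qed.

Lemma br1m_grad F G : SIm F -> SIm G -> br1m F G q J =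
  bform1 q J (gradq (slice F) p) (gradJ (slice F) p) (gradq (slice G) p) (gradJ (slice G) p).
Proof.
move=> [sF _] [sG _]; rewrite br1mE (nabla1_herm sF Gq HJ) (nabla1_herm sG Gq HJ).
by rewrite (d2m_herm sF Gq HJ) (d2m_herm sG Gq HJ).
Qed.

Lemma br2m_grad F G : SIm F -> SIm G -> br2m F G q J =
  bform2 q J (gradq (slice F) p) (gradJ (slice F) p) (gradq (slice G) p) (gradJ (slice G) p).
Proof.
move=> [sF _] [sG _]; rewrite br2mE (nabla1_herm sF Gq HJ) (nabla1_herm sG Gq HJ).
by rewrite (d2m_herm sF Gq HJ) (d2m_herm sG Gq HJ).
Qed.

Lemma pencil1_grad l F G : SIm F -> SIm G -> pencil l 1 F G q J =
  bform2 q (J + (Complex l 0)%:M) (gradq (slice F) p) (gradJ (slice F) p)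
    (gradq (slice G) p) (gradJ (slice G) p).
Proof.
move=> HF HG; rewrite /pencil /fadd /fscale br1m_grad // br2m_grad // mul1r addrC.
by rewrite bform2_shift //; exact: gradJ_herm.
Qed.

Lemma gradq_linear a b F G : SIm F -> SIm G ->
  gradq (slice (fadd (fscale a F) (fscale b G))) p =
  Complex a 0 *: gradq (slice F) p + Complex b 0 *: gradq (slice G) p.
Proof.
move=> [sF _] [sG _]; have dF v := @smooth_derivable R n U _ p v sF Up.
have dG v := @smooth_derivable R n U _ p v sG Up.
have D v : 'D_v (slice (fadd (fscale a F) (fscale b G))) p =
    a * 'D_v (slice F) p + b * 'D_v (slice G) p.
  have := is_deriveD (is_deriveZ a (DeriveDef (dF v) erefl)) (is_deriveZ b (DeriveDef (dG v) erefl)).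
  by case=> _ <-.
apply/matrixP => i j; rewrite !mxE; case: eqP => _; last by rewrite !mulr0 addr0.
by rewrite D; apply: complex_eqP; rewrite !(ReD, ImD, ReM, ImM) /=; ring.
Qed.

Lemma gradJ_linear a b F G : SIm F -> SIm G ->
  gradJ (slice (fadd (fscale a F) (fscale b G))) p =
  Complex a 0 *: gradJ (slice F) p + Complex b 0 *: gradJ (slice G) p.
Proof.
move=> [sF _] [sG _]; have dF v := @smooth_derivable R n U _ p v sF Up.
have dG v := @smooth_derivable R n U _ p v sG Up.
have D v : 'D_v (slice (fadd (fscale a F) (fscale b G))) p =
    a * 'D_v (slice F) p + b * 'D_v (slice G) p.
  have := is_deriveD (is_deriveZ a (DeriveDef (dF v) erefl)) (is_deriveZ b (DeriveDef (dG v) erefl)).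
  by case=> _ <-.
apply/matrixP => i j; rewrite !mxE !D.
move: ('D_(eA j i) (slice F) p) ('D_(eA j i) (slice G) p) => d1 d2.
move: ('D_(eB j i) (slice F) p) ('D_(eB j i) (slice G) p) => d3 d4.
by apply: complex_eqP; rewrite !(ReD, ImD, ReM, ImM) /=; ring.
Qed.

Lemma slice_point F : slice F p = F q J.
Proof. by rewrite /p lift_point /ext_pminus pminus_herm. Qed.

Lemma derive_fmul F G v : SIm F -> SIm G ->
  'D_v (slice (fmul F G)) p = F q J * 'D_v (slice G) p + G q J * 'D_v (slice F) p.
Proof.
move=> [sF _] [sG _]; have dF := @smooth_derivable R n U _ p v sF Up.
have dG := @smooth_derivable R n U _ p v sG Up.
have := is_deriveM (DeriveDef dF erefl) (DeriveDef dG erefl).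
by case=> _; rewrite !slice_point => <-.
Qed.

Lemma gradq_fmul F G : SIm F -> SIm G -> gradq (slice (fmul F G)) p =
  Complex (F q J) 0 *: gradq (slice G) p + Complex (G q J) 0 *: gradq (slice F) p.
Proof.
move=> HF HG; apply/matrixP => i j; rewrite !mxE; case: eqP => _; last by rewrite !mulr0 addr0.
rewrite derive_fmul //; move: ('D_(eq_ i) (slice F) p) ('D_(eq_ i) (slice G) p) => d1 d2.
by move: (F q J) (G q J) => s t; apply: complex_eqP; rewrite !(ReD, ImD, ReM, ImM) /=; ring.
Qed.

Lemma gradJ_fmul F G : SIm F -> SIm G -> gradJ (slice (fmul F G)) p =
  Complex (F q J) 0 *: gradJ (slice G) p + Complex (G q J) 0 *: gradJ (slice F) p.
Proof.
move=> HF HG; apply/matrixP => i j; rewrite !mxE !derive_fmul //.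
move: ('D_(eA j i) (slice F) p) ('D_(eA j i) (slice G) p) => d1 d2.
move: ('D_(eB j i) (slice F) p) ('D_(eB j i) (slice G) p) => d3 d4.
move: (F q J) (G q J) => s t.
by apply: complex_eqP; rewrite !(ReD, ImD, ReM, ImM) /=; ring.
Qed.

Lemma ip_linear a b X Y Z :
  ip X (Complex a 0 *: Y + Complex b 0 *: Z) = a * ip X Y + b * ip X Z.
Proof. by rewrite ipDr !ipZr. Qed.

Lemma comm_linear (s t : C) X Y Z : comm X (s *: Y + t *: Z) = s *: comm X Y + t *: comm X Z.
Proof.
by rewrite /comm mulmxDl mulmxDr -!scalemxAl -!scalemxAr opprD !scalerBr addrACA.
Qed.

Lemma commC X Y : comm X Y = - comm Y X.
Proof. by rewrite /comm opprB. Qed.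

(** Covers linearity and the Leibniz rule alike: the gradient of a product is a combination of
    gradients whose coefficients are function values. *)
Lemma bform1_linear a b M N D N1 D1 N2 D2 :
  bform1 q M N D (Complex a 0 *: N1 + Complex b 0 *: N2) (Complex a 0 *: D1 + Complex b 0 *: D2)
  = a * bform1 q M N D N1 D1 + b * bform1 q M N D N2 D2.
Proof.
have ar (x1 x2 y1 y2 z1 z2 w1 w2 : R) : a * x1 + b * x2 - (a * y1 + b * y2) +
   (a * z1 + b * z2 + (a * w1 + b * w2)) = a * (x1 - y1 + (z1 + w1)) + b * (x2 - y2 + (z2 + w2)).
  by ring.
rewrite /bform1 ip_linear [ip _ D]ipC ip_linear RqD !RqZ !comm_linear (ipDr (_ *: _ + _) (_ *: _ + _) M).
rewrite !ip_linear ar.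
rewrite (ipDr (comm (Rq q D) D1) _ M) (ipDr (comm (Rq q D) D2) _ M).
by rewrite (ipC N1 D) (ipC N2 D).
Qed.

Lemma bform2_linear a b M N D N1 D1 N2 D2 :
  bform2 q M N D (Complex a 0 *: N1 + Complex b 0 *: N2) (Complex a 0 *: D1 + Complex b 0 *: D2)
  = a * bform2 q M N D N1 D1 + b * bform2 q M N D N2 D2.
Proof.
have ar (x1 x2 y1 y2 z1 z2 : R) : a * x1 + b * x2 - (a * y1 + b * y2) +
   2 * (a * z1 + b * z2) = a * (x1 - y1 + 2 * z1) + b * (x2 - y2 + 2 * z2).
  by ring.
rewrite /bform2 mulmxDr -!scalemxAr RqD !RqZ [ip (_ + _) _]ipC !ip_linear ar.
by rewrite (ipC N1 (M *m D)) (ipC N2 (M *m D)).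
Qed.

Lemma bform1C M N D N1 D1 : bform1 q M N D N1 D1 = - bform1 q M N1 D1 N D.
Proof.
have ar (x y z : R) : x - y - z = - (y - x + z) by ring.
rewrite /bform1 (commC (Rq q D)) (commC D) -opprD ipNr ar.
by rewrite [in LHS](addrC (comm D1 (Rq q D))).
Qed.

Lemma br1m_anti F G : br1m F G q J = - br1m G F q J.
Proof. by rewrite !br1mE bform1C. Qed.

Lemma br2m_anti F G : br2m F G q J = - br2m G F q J.
Proof. by rewrite !br2mE bform2C. Qed.

Lemma br1m_linear a b F G H : SIm F -> SIm G -> SIm H ->
  br1m H (fadd (fscale a F) (fscale b G)) q J = a * br1m H F q J + b * br1m H G q J.
Proof.
move=> HF HG HH; rewrite (br1m_grad HH (SIm_fadd (SIm_fscale a HF) (SIm_fscale b HG))).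
rewrite (br1m_grad HH HF) (br1m_grad HH HG) (gradq_linear a b HF HG) (gradJ_linear a b HF HG).
exact: bform1_linear.
Qed.

Lemma br2m_linear a b F G H : SIm F -> SIm G -> SIm H ->
  br2m H (fadd (fscale a F) (fscale b G)) q J = a * br2m H F q J + b * br2m H G q J.
Proof.
move=> HF HG HH; rewrite (br2m_grad HH (SIm_fadd (SIm_fscale a HF) (SIm_fscale b HG))).
rewrite (br2m_grad HH HF) (br2m_grad HH HG) (gradq_linear a b HF HG) (gradJ_linear a b HF HG).
exact: bform2_linear.
Qed.

Lemma br1m_leibniz F G H : SIm F -> SIm G -> SIm H ->
  br1m F (fmul G H) q J = br1m F G q J * H q J + G q J * br1m F H q J.
Proof.
move=> HF HG HH; rewrite (br1m_grad HF (SIm_fmul HG HH)).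
rewrite (gradq_fmul HG HH) (gradJ_fmul HG HH) bform1_linear -(br1m_grad HF HG) -(br1m_grad HF HH).
by rewrite addrC [br1m F G q J * _]mulrC.
Qed.

Lemma br2m_leibniz F G H : SIm F -> SIm G -> SIm H ->
  br2m F (fmul G H) q J = br2m F G q J * H q J + G q J * br2m F H q J.
Proof.
move=> HF HG HH; rewrite (br2m_grad HF (SIm_fmul HG HH)).
rewrite (gradq_fmul HG HH) (gradJ_fmul HG HH) bform2_linear -(br2m_grad HF HG) -(br2m_grad HF HH).
by rewrite addrC [br2m F G q J * _]mulrC.
Qed.

End PointValues.

Lemma pencil_eqm a b F F' G : eqm F F' -> eqm (pencil a b F G) (pencil a b F' G).
Proof.
move=> FF q J Gq HJ; rewrite /pencil /fadd /fscale !br1mE !br2mE.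
by rewrite (nabla1_eqm FF Gq HJ) (d2m_eqm FF Gq HJ).
Qed.

End PoissonStructure.

(** * The Jacobi identity for all members of the pencil *)

Section Jacobi.
Context {R : realType} {n : nat}.
Local Notation C := R[i].
Local Notation Mat := 'M[C]_n.
Local Notation E := ('rV[R]_n * 'M[R]_n * 'M[R]_n)%type.
Local Notation U := (@Ereg R n).
Local Notation Im := (@complex.Im R).
Implicit Types (q x : 'rV[R]_n) (Y J D N M : Mat) (F G H : @MFun R n) (a b l : R).
Local Notation slice F := (Defs.lift (ext_pminus F)).

(** The inner bracket is differentiated on an open set, so its formula is needed at every regular
    point; invariance of the gradients under [slice_proj] reduces this to Hermitian points. *)
Lemma slice_pencil l G H (y : E) : SIm G -> SIm H -> U y ->
  bform2 y.1.1 (Mshift l y) (gradq (slice G) y) (gradJ (slice G) y)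
    (gradq (slice H) y) (gradJ (slice H) y) = slice (pencil l 1 G H) y.
Proof.
move=> HG HH Uy.
have qP K : gradq (slice K) (slice_proj y) = gradq (slice K) y.
  apply/matrixP => i j; rewrite [LHS]mxE [RHS]mxE.
  by rewrite (derive_proj (eq_ i) y (ext_pminus_proj K)).
have JP K : gradJ (slice K) (slice_proj y) = gradJ (slice K) y.
  apply/matrixP => i j; rewrite [LHS]mxE [RHS]mxE.
  rewrite (derive_proj (eA j i) y (ext_pminus_proj K)).
  by rewrite (derive_proj (eB j i) y (ext_pminus_proj K)).
rewrite -!qP -!JP; apply/esym.
exact: (@pencil1_grad R n y.1.1 (pminus (cplx y.1.2 y.2)) Uy (is_herm_pminus _) l G H HG HH).
Qed.

Section AtPoint.
Context (q : 'rV[R]_n) (J : Mat) (l : R) (Gq : Greg q) (HJ : is_herm J).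
Let p := point q J.
Let Up : U p := Gq.
Let M : Mat := J + (Complex l 0)%:M.

Lemma Mshift_point : Mshift l p = M.
Proof. by rewrite /Mshift /p /= cplx_parts pminus_herm. Qed.

Lemma is_herm_shift : is_herm M.
Proof. by apply: is_hermD => //; exact: adj_scalar. Qed.

Definition ham F : E := point (hamq M (gradJ (slice F) p))
  (hamJ q M (gradq (slice F) p) (gradJ (slice F) p)).

Lemma bform2_ham_derive F g : smooth_on U g -> (forall y, g (slice_proj y) = g y) ->
  bform2 q M (gradq (slice F) p) (gradJ (slice F) p) (gradq g p) (gradJ g p) = 'D_(ham F) g p.
Proof.
move=> sg Pg; rewrite bform2_ham; [|exact: is_herm_shift|exact: is_herm_gradJ_proj].
rewrite (smooth_derive_point _ _ (@open_Ereg R n) sg Up) ip_gradq; congr (_ + _).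
by apply: eq_bigr => k _; rewrite [hamq _ _ 0 k]mxE.
Qed.

Lemma pencil_ham F G : SIm F -> SIm G -> pencil l 1 F G q J = 'D_(ham F) (slice G) p.
Proof.
move=> HF HG; rewrite (pencil1_grad Gq HJ l HF HG); apply: bform2_ham_derive.
  by case: HG.
by move=> y; exact: ext_pminus_proj.
Qed.

Definition ham_explicit F G H : R :=
  let N1 := gradq (slice G) p in let N2 := gradq (slice H) p in
  let D1 := gradJ (slice G) p in let D2 := gradJ (slice H) p in
  let Y := hamJ q M (gradq (slice F) p) (gradJ (slice F) p) in
  ip N1 (Y *m D2) - ip N2 (Y *m D1) +
    2 * (ip (Y *m D1) (Rq q (M *m D2)) +
      ip (M *m D1) (Rq_dot q (hamq M (gradJ (slice F) p)) (M *m D2)) +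
      ip (M *m D1) (Rq q (Y *m D2))).

(** The outer bracket differentiates the inner one along [ham F], a constant vector frozen at [p]. A
    bracket with a differentiated gradient is once more a derivative along [ham G] or [ham H], and
    the explicit variation is kept apart. *)
Lemma pencil_nested F G H : SIm F -> SIm G -> SIm H ->
  pencil l 1 F (pencil l 1 G H) q J =
  - 'D_(ham H) ('D_(ham F) (slice G)) p + 'D_(ham G) ('D_(ham F) (slice H)) p
  + ham_explicit F G H.
Proof.
move=> HF HG HH; rewrite (pencil_ham HF (SIm_pencil l 1 HG HH)).
have [sG _] := HG; have [sH _] := HH; set v := ham F.
have EY : pminus (cplx v.1.2 v.2) = hamJ q M (gradq (slice F) p) (gradJ (slice F) p).
  by rewrite /v /ham /= cplx_parts pminus_herm //; apply: is_herm_hamJ; exact: is_herm_shift.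
have DB := is_derive_bform2 Up (isDM_Mshift p v l) (isDM_gradq v sG Up) (isDM_gradJ v sG Up)
  (isDM_gradq v sH Up) (isDM_gradJ v sH Up).
case: DB => d1 d2.
have [_ ->] := open_eq_derive (@open_Ereg R n) Up (fun y Uy => slice_pencil l HG HH Uy) d1.
rewrite d2 EY Mshift_point; congr (_ + _ + _).
  (* The differentiated function sits in the first slot, so antisymmetry is needed before reading
     the bracket as a derivative along [ham H]. *)
  rewrite bform2C; congr (- _).
  exact: (bform2_ham_derive H (smooth_on_derive v sG) (fun y => derive_proj v y (ext_pminus_proj G))).
exact: (bform2_ham_derive G (smooth_on_derive v sH) (fun y => derive_proj v y (ext_pminus_proj H))).
Qed.

(** The shift adds l times a diagonal entry of a Hermitian gradient, which is real. *)
Lemma shifted_moment_real F k : SIm F -> Im ((M *m gradJ (slice F) p) k k) = 0.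
Proof.
move=> HF; have H0 := moment_real k HF Gq HJ; rewrite -/p in H0.
have := congr1 Im (congr1 (fun X : Mat => X k k) (gradJ_herm J Gq HF)).
rewrite -/p adjE Im_conj /M mulmxDl mul_scalar_mx.
move: (gradJ (slice F) p) H0 => D H0 H.
have -> : (J *m D + Complex l 0 *: D) k k = (J *m D) k k + Complex l 0 * D k k.
  by rewrite mxE [X in _ + X]mxE.
rewrite ImD H0 ImM /= mul0r addr0 add0r.
have -> : Im (D k k) = 0 by move: H; move: (Im _) => t H; lra.
by rewrite mulr0.
Qed.

Lemma ham_explicit_jacobi F G H : SIm F -> SIm G -> SIm H ->
  ham_explicit F G H + ham_explicit G H F + ham_explicit H F G = 0.
Proof.
move=> HF HG HH; apply: ham_jacobi => //; try exact: is_diag_herm_gradq;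
  try exact: gradJ_herm; try (by move=> k; exact: shifted_moment_real).
exact: is_herm_shift.
Qed.

Lemma pencil1_jacobi F G H : SIm F -> SIm G -> SIm H ->
  pencil l 1 F (pencil l 1 G H) q J + pencil l 1 G (pencil l 1 H F) q J
  + pencil l 1 H (pencil l 1 F G) q J = 0.
Proof.
move=> HF HG HH.
rewrite (pencil_nested HF HG HH) (pencil_nested HG HH HF) (pencil_nested HH HF HG).
have [sF _] := HF; have [sG _] := HG; have [sH _] := HH.
(* Frozen directions commute, so the six second derivatives cancel in pairs, one pair for each
   function. *)
have S1 := smooth_schwarz (ham F) (ham H) (@open_Ereg R n) sG Up.
have S2 := smooth_schwarz (ham F) (ham G) (@open_Ereg R n) sH Up.
have S3 := smooth_schwarz (ham G) (ham H) (@open_Ereg R n) sF Up.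
have ar (r r' s s' t t' x y z : R) : r = r' -> s = s' -> t = t' -> x + y + z = 0 ->
    - r + s + x + (- s' + t + y) + (- t' + r' + z) = 0.
  by move=> -> -> -> H0; rewrite -[RHS]H0; ring.
exact: ar S1 S2 S3 (ham_explicit_jacobi HF HG HH).
Qed.

End AtPoint.

Lemma pencil_anti a b F G q J : pencil a b F G q J = - pencil a b G F q J.
Proof. by rewrite /pencil /fadd /fscale br1m_anti br2m_anti; ring. Qed.

Lemma fscale1 F : fscale 1 F = F.
Proof. by apply/funext => q; apply/funext => J; rewrite /fscale mul1r. Qed.

Lemma pencil_linear a b (c : R) F G H q J : Greg q -> is_herm J -> SIm F -> SIm G -> SIm H ->
  pencil a b (fadd (fscale c F) G) H q J = c * pencil a b F H q J + pencil a b G H q J.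
Proof.
move=> Gq HJ HF HG HH.
have E1 := br1m_linear Gq HJ c 1 HF HG HH; have E2 := br2m_linear Gq HJ c 1 HF HG HH.
rewrite !fscale1 in E1 E2.
have A1 := br1m_anti q J (fadd (fscale c F) G) H; rewrite E1 in A1.
have A2 := br2m_anti q J (fadd (fscale c F) G) H; rewrite E2 in A2.
rewrite {1}/pencil [in LHS]/fadd [in LHS]/fscale A1 A2.
have -> := pencil_anti a b F H q J; have -> := pencil_anti a b G H q J.
rewrite /pencil /fadd /fscale.
by move: (br1m H F q J) (br1m H G q J) (br2m H F q J) (br2m H G q J) => x y z w; ring.
Qed.

Lemma pencil_leibniz a b F G H q J : Greg q -> is_herm J -> SIm F -> SIm G -> SIm H ->
  pencil a b F (fmul G H) q J = pencil a b F G q J * H q J + G q J * pencil a b F H q J.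
Proof.
move=> Gq HJ HF HG HH; have E1 := br1m_leibniz Gq HJ HF HG HH.
have E2 := br2m_leibniz Gq HJ HF HG HH.
rewrite {1}/pencil [in LHS]/fadd [in LHS]/fscale E1 E2 /pencil /fadd /fscale.
move: (br1m F G q J) (br1m F H q J) (br2m F G q J) (br2m F H q J) (G q J) (H q J).
by move=> x y z w s t; ring.
Qed.

Lemma pencil_jacobi a b F G H q J : Greg q -> is_herm J -> SIm F -> SIm G -> SIm H ->
  pencil a b F (pencil a b G H) q J + pencil a b G (pencil a b H F) q J
  + pencil a b H (pencil a b F G) q J = 0.
Proof.
move=> Gq HJ HF HG HH.
have ex s t F' G' H' : SIm F' -> SIm G' -> SIm H' -> pencil s t F' (pencil s t G' H') q J =
    s * (s * br1m F' (br1m G' H') q J + t * br1m F' (br2m G' H') q J)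
    + t * (s * br2m F' (br1m G' H') q J + t * br2m F' (br2m G' H') q J).
  move=> HF' HG' HH'; rewrite {1}/pencil /fadd /fscale.
  have S1 := SIm_br1m HG' HH'; have S2 := SIm_br2m HG' HH'.
  by rewrite (br1m_linear Gq HJ s t S1 S2 HF') (br2m_linear Gq HJ s t S1 S2 HF').
(* The value at l = 0 gives the coefficient of b^2; the values at 1 and -1 then separate those of
   a^2 and a b. *)
have ar (x1 x2 x3 x4 y1 y2 y3 y4 z1 z2 z3 z4 : R) :
    (forall l, l * (l * x1 + 1 * x2) + 1 * (l * x3 + 1 * x4)
     + (l * (l * y1 + 1 * y2) + 1 * (l * y3 + 1 * y4))
     + (l * (l * z1 + 1 * z2) + 1 * (l * z3 + 1 * z4)) = 0) ->
    a * (a * x1 + b * x2) + b * (a * x3 + b * x4)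
     + (a * (a * y1 + b * y2) + b * (a * y3 + b * y4))
     + (a * (a * z1 + b * z2) + b * (a * z3 + b * z4)) = 0.
  move=> Hl; have H0 := Hl 0; have H1 := Hl 1; have H2 := Hl (-1).
  have E4 : x4 + y4 + z4 = 0 by lra.
  have E1 : x1 + y1 + z1 = 0 by lra.
  have E23 : x2 + y2 + z2 + (x3 + y3 + z3) = 0 by lra.
  transitivity (a ^+ 2 * (x1 + y1 + z1) + a * b * (x2 + y2 + z2 + (x3 + y3 + z3))
    + b ^+ 2 * (x4 + y4 + z4)); first by ring.
  by rewrite E1 E4 E23 !mulr0 !addr0.
rewrite (ex a b _ _ _ HF HG HH) (ex a b _ _ _ HG HH HF) (ex a b _ _ _ HH HF HG).
apply: ar => l; have := pencil1_jacobi l Gq HJ HF HG HH.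
by rewrite (ex l 1 _ _ _ HF HG HH) (ex l 1 _ _ _ HG HH HF) (ex l 1 _ _ _ HH HF HG).
Qed.

End Jacobi.

Theorem theorem4p3 (R : realType) (n : nat) :
  (forall (F H f h : @MFun R n),
     SIm F -> SIm H -> SI0 f -> SI0 h -> extends f F -> extends h H ->
     forall q J, Greg q -> is_herm J ->
       br1 f h q J = br1m F H q J /\ br2 f h q J = br2m F H q J)
  /\
  (forall a1 a2 : R,
     poisson_m (fun F H : @MFun R n => fadd (fscale a1 (br1m F H)) (fscale a2 (br2m F H)))).
Proof.
split=> [F H f h _ _ [sf _] [sh _] fF hH q J Gq HJ|a1 a2].
  exact: restriction_formulas.
split; first by move=> F H; exact: SIm_pencil.
split; first by move=> F F' H _ _ _; exact: pencil_eqm.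
split; first by move=> a F G H HF HG HH q J Gq HJ; exact: pencil_linear.
split.
  move=> F H _ _ q J _ _; apply: etrans (pencil_anti a1 a2 F H q J) _.
  by rewrite /fscale mulN1r.
split; first by move=> F G H HF HG HH q J Gq HJ; exact: pencil_leibniz.
by move=> F G H HF HG HH q J Gq HJ; exact: pencil_jacobi.
Qed.
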